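(* Let $X$ be a quandle, let $G$ be a quandle module over $X$ with structure maps $\eta_{x,y},\tau_{x,y}$, and let $\alpha_{x,y}(a,b)=\eta_{x,y}(a)+\tau_{x,y}(b)$ for $x,y\in X$, $a,b\in G$. Let $L$ be a link represented as the closure $\hat w$ of a $k$-braid word $w$, and let $\mathrm{Col}_X(L)$ be the set of colorings of $L$ by $X$. For $\mathcal C\in \mathrm{Col}_X(L)$ let $\vec x\in X^k$ be the color vector of the bottom strings of $w$ obtained by restricting $\mathcal C$. Then the family $$\tilde\Phi(X,\alpha;L)=\{\,G^k/\mathrm{Im}(M(w,\vec x)-I)\,\}_{\mathcal C\in \mathrm{Col}_X(L)}$$ of isomorphism classes of modules, where $I$ is the identity of $G^k$, is independent of the choice of the braid word $w$ representing $L$ as its closure, and thus is a link invariant. That is, if $w$ (a $k$-braid word) and $w'$ (a $k'$-braid word) have closures representing the same link, then there is a bijection between the corresponding sets of colorings under which the corresponding quotients $G^k/\mathrm{Im}(M(w,\vec x)-I)$ and $G^{k'}/\mathrm{Im}(M(w',\vec x')-I)$ are isomorphic.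
   Context: A quandle is a set $X$ with a binary operation $*$ such that (I) $a*a=a$; (II) for all $a,b$ there is a unique $c$ with $a=c*b$, written $c=a\,\bar{*}\,b$; (III) $(a*b)*c=(a*c)*(b*c)$. A quandle module over $X$ is an abelian group $G$ with automorphisms $\eta_{x,y}\in\mathrm{Aut}(G)$ and endomorphisms $\tau_{x,y}\in\mathrm{End}(G)$ ($x,y\in X$) such that for all $x,y,z\in X$: $\eta_{x*y,z}\eta_{x,y}=\eta_{x*z,y*z}\eta_{x,z}$; $\eta_{x*y,z}\tau_{x,y}=\tau_{x*z,y*z}\eta_{y,z}$; $\tau_{x*y,z}=\eta_{x*z,y*z}\tau_{x,z}+\tau_{x*z,y*z}\tau_{y,z}$; $\tau_{x,x}+\eta_{x,x}=1$. Then $\tilde X=G\times X$ is a quandle under $(a,x)*(b,y)=(\alpha_{x,y}(a,b),x*y)$. Braid action: for any quandle $Q$, a $k$-braid word (a word in $\sigma_1^{\pm1},\dots,\sigma_{k-1}^{\pm1}$) acts from the left on $Q^k$, with $(ww')\cdot\vec r=w\cdot(w'\cdot\vec r)$. The generator $\sigma_i$ replaces the entries $(r_i,r_{i+1})$ by $(r_{i+1},\,r_i*r_{i+1})$, and $\sigma_i^{-1}$ replaces $(r_i,r_{i+1})$ by $(r_{i+1}\,\bar{*}\,r_i,\,r_i)$; other entries are unchanged. The vector $\vec r$ gives the colors of the bottom strings and $w\cdot\vec r$ the colors of the top strings. Colorings of the closure $\hat w$ by $X$ correspond to vectors $\vec x\in X^k$ with $w\cdot\vec x=\vec x$. The map $M(w,\vec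 x):G^k\to G^k$ is defined by: for $\vec a\in G^k$, $M(w,\vec x)\cdot\vec a=\vec b$, where $w\cdot\big((a_1,x_1),\dots,(a_k,x_k)\big)=\big((b_1,y_1),\dots,(b_k,y_k)\big)$ for the action on $\tilde X^k$. It is a homomorphism of abelian groups. *)

(* Defs.v *)
From HB Require Import structures.
From Stdlib Require Import Relation_Operators.
From mathcomp Require Import all_boot all_algebra boolp.

Set Implicit Arguments.
Unset Strict Implicit.
Unset Printing Implicit Defensive.

Import GRing.Theory.
Local Open Scope ring_scope.

Reserved Notation "x |> y" (at level 40, left associativity).
Reserved Notation "x |>^-1 y" (at level 40, left associativity).

(** * Quandles and quandle modules *)

(* [qbarP] is the axiom that for all [a], [b] there is a unique [c] with
   [a = c |> b], the unique solution being named [a |>^-1 b]. *)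
Record quandle := Quandle {
  qsort :> Type;
  qop : qsort -> qsort -> qsort;
  qbar : qsort -> qsort -> qsort;
  qopxx : forall a, qop a a = a;
  qbarP : forall a b c, a = qop c b <-> c = qbar a b;
  qopD : forall a b c, qop (qop a b) c = qop (qop a c) (qop b c)
}.

Notation "x |> y" := (qop x y).
Notation "x |>^-1 y" := (qbar x y).

Record quandle_module (X : quandle) (G : zmodType) := QuandleModule {
  eta : X -> X -> {additive G -> G};
  eta_inv : X -> X -> G -> G;
  tau : X -> X -> {additive G -> G};
  etaK : forall x y, cancel (eta x y) (eta_inv x y);
  eta_invK : forall x y, cancel (eta_inv x y) (eta x y);
  eta_eta : forall x y z a,
    eta (x |> y) z (eta x y a) = eta (x |> z) (y |> z) (eta x z a);
  eta_tau : forall x y z a,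
    eta (x |> y) z (tau x y a) = tau (x |> z) (y |> z) (eta y z a);
  tau_op : forall x y z a,
    tau (x |> y) z a
    = eta (x |> z) (y |> z) (tau x z a) + tau (x |> z) (y |> z) (tau y z a);
  tau_eta : forall x a, tau x x a + eta x x a = a
}.

Section Extension.
Variables (X : quandle) (G : zmodType) (m : quandle_module X G).

Definition alpha (x y : X) (a b : G) : G := eta m x y a + tau m x y b.

Definition ext_op (p q : G * X) : G * X :=
  (alpha p.2 q.2 p.1 q.1, p.2 |> q.2).

Definition ext_bar (p q : G * X) : G * X :=
  let z := p.2 |>^-1 q.2 in
  (eta_inv m z q.2 (p.1 - tau m z q.2 q.1), z).

Lemma ext_opxx p : ext_op p p = p.
Proof. by case: p => a x; rewrite /ext_op /alpha /= qopxx addrC tau_eta. Qed.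

Lemma ext_barP p q r : p = ext_op r q <-> r = ext_bar p q.
Proof.
case: p q r => [a x] [b y] [c z]; rewrite /ext_op /ext_bar /alpha /=; split.
  by case=> -> /qbarP <-; rewrite addrK etaK.
by case=> -> ->; rewrite eta_invK addrNK; congr (_, _); apply/qbarP.
Qed.

Lemma ext_opD p q r : ext_op (ext_op p q) r = ext_op (ext_op p r) (ext_op q r).
Proof.
case: p q r => [a x] [b y] [c z]; rewrite /ext_op /alpha /= -qopD.
rewrite tau_op !raddfD /= eta_eta eta_tau -!addrA; congr (_ + _, _).
by rewrite !addrA; congr (_ + _); rewrite addrC.
Qed.

(* The quandle structure on G x X. *)
Definition ext_quandle : quandle := Quandle ext_opxx ext_barP ext_opD.

End Extension.

(** * Braid words and their action *)

(* [(i, true)] is the generator exchanging the (0-based) strings [i] and [i.+1],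
   and [(i, false)] is its inverse. *)
Definition letter (k : nat) : Type := ('I_k.-1 * bool)%type.
Definition braid_word (k : nat) : Type := seq (letter k).

Lemma ltn_lo k (i : 'I_k.-1) : (i < k)%N.
Proof. by case: k i => [[]|k] // i; apply: ltnW (ltn_ord i). Qed.
Lemma ltn_hi k (i : 'I_k.-1) : (i.+1 < k)%N.
Proof. by case: k i => [[]|k] // i; apply: (ltn_ord i). Qed.

Definition lo k (i : 'I_k.-1) : 'I_k := Ordinal (ltn_lo i).
Definition hi k (i : 'I_k.-1) : 'I_k := Ordinal (ltn_hi i).

Definition act_letter (Q : quandle) k (l : letter k) (r : {ffun 'I_k -> Q}) :
    {ffun 'I_k -> Q} :=
  let: (i, s) := l in
  let u := r (lo i) in let v := r (hi i) in
  [ffun j => if j == lo i then (if s then v else v |>^-1 u)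
             else if j == hi i then (if s then u |> v else u)
             else r j].

Definition act (Q : quandle) k (w : braid_word k) (r : {ffun 'I_k -> Q}) :
    {ffun 'I_k -> Q} :=
  foldr (@act_letter Q k) r w.

Definition colorings (X : quandle) k (w : braid_word k) : Type :=
  {x : {ffun 'I_k -> X} | act w x = x}.

(** * The map M(w, x) and the quotient by the image of M(w, x) - I *)

Section BraidMap.
Variables (X : quandle) (G : zmodType) (m : quandle_module X G) (k : nat).
Implicit Types (w : braid_word k) (x : {ffun 'I_k -> X}) (a b : {ffun 'I_k -> G}).

Definition vpair a x : {ffun 'I_k -> ext_quandle m} := [ffun i => (a i, x i)].

Definition braid_map w x a : {ffun 'I_k -> G} :=
  [ffun i => (act w (vpair a x) i).1].

Lemma act_vpair w x a : act w (vpair a x) = vpair (braid_map w x a) (act w x).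
Proof.
suff H i : (act w (vpair a x) i).2 = act w x i.
  by apply/ffunP => i; rewrite !ffunE -H; case: (act _ _ i).
elim: w i => [|[j s] w IHw] i /=; first by rewrite ffunE.
by rewrite !ffunE; case: eqP => _; [|case: eqP => _] => //; case: s;
  rewrite /= ?IHw.
Qed.

Lemma braid_map_cons l w x a :
  braid_map (l :: w) x a = braid_map [:: l] (act w x) (braid_map w x a).
Proof. by apply/ffunP => i; rewrite !ffunE /= act_vpair. Qed.

Lemma eta_invB (y z : X) : {morph eta_inv m y z : g h / g - h}.
Proof.
move=> g h; apply: (can_inj (etaK m y z)).
by rewrite raddfB /= !eta_invK.
Qed.

Lemma braid_map_is_zmod_morphism w x : zmod_morphism (braid_map w x).
Proof.
elim: w x => [|[j s] w IHw] x a b.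
  by apply/ffunP => i; rewrite !ffunE.
rewrite 3!(braid_map_cons (j, s) w x) IHw.
move: (braid_map w x a) (braid_map w x b) => {}a {}b.
apply/ffunP => i; rewrite /braid_map /= !ffunE /=.
case: eqP => _; [|case: eqP => _]; case: s; rewrite /= ?ffunE //=.
  by rewrite -eta_invB raddfB /=; congr eta_inv; rewrite !opprD addrACA.
by rewrite /alpha !raddfB /= opprD addrACA.
Qed.

HB.instance Definition _ w x :=
  GRing.isZmodMorphism.Build _ _ (braid_map w x) (braid_map_is_zmod_morphism w x).

Definition im_map_sub w x : {pred {ffun 'I_k -> G}} :=
  fun b => `[< exists a, b = braid_map w x a - a >].

Lemma im_map_sub_zmod_closed w x : zmod_closed (im_map_sub w x).
Proof.
split; first by apply/asboolP; exists 0; rewrite raddf0 subrr.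
move=> _ _ /asboolP[a ->] /asboolP[b ->]; apply/asboolP; exists (a - b).
by rewrite (braid_map_is_zmod_morphism w x a b) !opprD addrACA.
Qed.

HB.instance Definition _ w x :=
  GRing.isZmodClosed.Build _ (im_map_sub w x) (im_map_sub_zmod_closed w x).

(* The abelian group G^k / Im (M(w, x) - I). *)
Definition braid_quotient w x : zmodType := Quotient.quot (im_map_sub w x).

End BraidMap.

Definition zmod_isomorphic (A B : zmodType) : Prop :=
  exists f : {additive A -> B}, bijective f.

(** * Oriented link diagrams *)

(* A diagram is presented as a planar diagram code: it is cut into oriented edges,
   labelled by natural numbers, which meet at crossings and at bivalent points.
   A strand [(i, o)] passing a vertex enters it along edge [i] and leaves it along
   edge [o].  [Crossing s u o] is a crossing with under-strand [u] and over-strand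
   [o].  When both strands are drawn pointing upwards, the over-strand runs from
   bottom right to top left if [s] is [true], from bottom left to top right if [s]
   is [false].  A component without crossings is a cycle of points. *)
Definition strand : Type := (nat * nat)%type.

Inductive piece :=
  | Point of strand
  | Crossing of bool & strand & strand.

Definition piece_code (p : piece) : strand + bool * strand * strand :=
  match p with Point a => inl a | Crossing s u o => inr (s, u, o) end.
Definition piece_decode (c : strand + bool * strand * strand) : piece :=
  match c with inl a => Point a | inr (s, u, o) => Crossing s u o end.
Lemma piece_codeK : cancel piece_code piece_decode.
Proof. by case. Qed.
HB.instance Definition _ := Equality.copy piece (can_type piece_codeK).

Definition diagram : Type := seq piece.

Definition strands (p : piece) : seq strand :=
  match p with Point a => [:: a] | Crossing _ u o => [:: u; o] end.

Definition ins (D : diagram) : seq nat := [seq a.1 | a <- flatten (map strands D)].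
Definition outs (D : diagram) : seq nat := [seq a.2 | a <- flatten (map strands D)].

(* Each edge leaves exactly one vertex and enters exactly one vertex. *)
Definition well_formed (D : diagram) : bool :=
  uniq (outs D) && perm_eq (ins D) (outs D).

Definition edges (D : diagram) : seq nat := outs D.

(* Half-edges: [(e, false)] is the initial half of edge [e], [(e, true)] its final
   half. *)
Definition darts (D : diagram) : seq (nat * bool) :=
  [seq (e, b) | e <- edges D, b <- [:: false; true]].

(* The half-edges at a vertex, in counterclockwise order. *)
Definition ccw (p : piece) : seq (nat * bool) :=
  match p with
  | Point a => [:: (a.1, true); (a.2, false)]
  | Crossing true u o => [:: (u.1, true); (o.1, true); (u.2, false); (o.2, false)]
  | Crossing false u o => [:: (u.1, true); (o.2, false); (u.2, false); (o.1, true)]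
  end.

(* As [next c d = d] for [d] outside [c], this rotates [d] about its vertex. *)
Definition rotate (D : diagram) (d : nat * bool) : nat * bool :=
  foldl (fun d p => next (ccw p) d) d D.

(* The orbits of [face_step] are the boundaries of the faces of the surface
   obtained by thickening the diagram and capping it off with discs. *)
Definition face_step (D : diagram) (d : nat * bool) : nat * bool :=
  rotate D (d.1, ~~ d.2).

Definition face (D : diagram) (d : nat * bool) : seq (nat * bool) :=
  [seq d' <- darts D | d' \in traject (face_step D) d (size (darts D))].

Definition faces (D : diagram) : seq (seq (nat * bool)) :=
  undup [seq face D d | d <- darts D].

Definition labels (p : piece) : seq nat :=
  flatten [seq [:: a.1; a.2] | a <- strands p].

Definition neighbours (D : diagram) (s : seq nat) : seq nat :=
  [seq e <- edges D | has (fun p => (e \in labels p) && has (mem s) (labels p)) D].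

Definition components (D : diagram) : seq (seq nat) :=
  undup [seq iter (size D) (neighbours D) [:: e] | e <- edges D].

(* Euler's formula V - E + F = 2 c: every connected component of the map
   lies on a sphere.  The relative position of distinct connected components is not
   recorded, since it does not affect the link type. *)
Definition planar (D : diagram) : bool :=
  (size D + size (faces D) == size (edges D) + 2 * size (components D))%N.

Definition link_diagram (D : diagram) : bool := well_formed D && planar D.

(** * Reidemeister moves *)

Definition relabel (f : nat -> nat) (D : diagram) : diagram :=
  let g (a : strand) := (f a.1, f a.2) in
  [seq match p with
       | Point a => Point (g a)
       | Crossing s u o => Crossing s (g u) (g o)
       end | p <- D].

(* A kink: the strand from [a] to [b] crosses itself along the loop [e], passing
   first over if [over_first] and first under otherwise. *)
Definition kink (s over_first : bool) (a e b : nat) : piece :=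
  if over_first then Crossing s (e, b) (a, e) else Crossing s (a, e) (e, b).

(* A strand from [a] to [b] passing under a strand from [c] to [d]; [parallel] tells
   whether the two strands run in the same direction along the bigon. *)
Definition bigon (s parallel : bool) (a e b c f d : nat) : diagram :=
  if parallel
  then [:: Crossing s (a, e) (c, f); Crossing (~~ s) (e, b) (f, d)]
  else [:: Crossing s (a, e) (f, d); Crossing (~~ s) (e, b) (c, f)].

(* Three strands [t], [m], [b] (top, middle, bottom), each given by its incoming,
   inner and outgoing edge, crossing pairwise around a triangle.  The booleans [ot],
   [om], [ob] tell whether [t] crosses [m] before [b], [m] crosses [t] before [b]
   and [b] crosses [t] before [m]; reversing a strand changes its boolean and the
   types of its two crossings, and a mirror image changes [s]. *)
Definition leg (first : bool) (t : nat * nat * nat) : strand :=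
  let: (i, e, o) := t in if first then (i, e) else (e, o).

Definition triangle (s ot om ob : bool) (t m b : nat * nat * nat) : diagram :=
  [:: Crossing (s (+) ot (+) om) (leg om m) (leg ot t);
      Crossing (s (+) ot (+) ob) (leg ob b) (leg (~~ ot) t);
      Crossing (s (+) om (+) ob) (leg (~~ ob) b) (leg (~~ om) m)].

(* Together with well-formedness of both sides, this forces the inner edges created
   by a move to be new. *)
Inductive reidemeister : diagram -> diagram -> Prop :=
  | Reid_perm D D' : perm_eq D D' -> reidemeister D D'
  | Reid_relabel f D : {in edges D &, injective f} -> reidemeister D (relabel f D)
  | Reid_point a b D : a != b ->
      reidemeister (Point (a, b) :: D) (relabel (fun e => if e == b then a else e) D)
  | Reid_1 s over_first a e b D :
      reidemeister (Point (a, b) :: D) (kink s over_first a e b :: D)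
  | Reid_2 s parallel a e b c f d D :
      reidemeister (Point (a, b) :: Point (c, d) :: D)
                   (bigon s parallel a e b c f d ++ D)
  | Reid_3 s ot om ob t m b D :
      reidemeister (triangle s ot om ob t m b ++ D)
                   (triangle s (~~ ot) (~~ om) (~~ ob) t m b ++ D).

(* Two diagrams represent the same oriented link. *)
Definition same_link : diagram -> diagram -> Prop :=
  clos_refl_sym_trans diagram
    (fun D D' => [/\ link_diagram D, link_diagram D' & reidemeister D D']).

(** * Closure of a braid word *)

(* [j * k + i] labels string [i] at height [j]; strings run upwards. *)
Definition level (k : nat) (l : letter k) (j : nat) : diagram :=
  let e h i := (h * k + i)%N in
  let i := val l.1 in
  let right_up := (e j i, e j.+1 i.+1) in
  let left_up := (e j i.+1, e j.+1 i) in
  (if l.2 then Crossing true right_up left_up else Crossing false left_up right_up)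
  :: [seq Point (e j n, e j.+1 n) | n <- iota 0 k & (n != i) && (n != i.+1)].

(* The last letter of the word acts first, hence is the lowest one. *)
Fixpoint braid_diagram (k : nat) (w : braid_word k) : diagram :=
  if w is l :: w' then level l (size w') ++ braid_diagram w' else [::].

Definition braid_closure (k : nat) (w : braid_word k) : diagram :=
  braid_diagram w ++ [seq Point (size w * k + n, n)%N | n <- iota 0 k].

(* Main.v *)
(* Label every edge of a colored diagram by a homomorphism G -> A, subject at each
   crossing to the transpose of alpha, so that labels are determined backwards along
   the strands.  On the closure of a braid such labelings are the homomorphisms
   f : G^k -> A with f M = f, that is, the homomorphisms from G^k / Im (M - I) to A;
   hence the quotient is determined up to isomorphism as the object representing
   A |-> {labelings of the diagram with values in A}.  Since the rule is local, it is
   enough to see that each Reidemeister move extends every pair (coloring, labeling)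
   uniquely from the edges outside a disc to those inside. *)
From HB Require Import structures.
From mathcomp Require Import all_boot all_algebra boolp zify.
Require Import Defs.

Set Implicit Arguments.
Unset Strict Implicit.
Unset Printing Implicit Defensive.

Import GRing.Theory.
Local Open Scope ring_scope.

(** * Labels at a crossing *)

(** The intermediate diagrams of a chain of moves are not braid closures, so no map [M] is attached
    to them; labelings make sense on all of them. Labeling edges by elements of [G] would only give
    the fixed vectors, that is, the kernel of [M - I]; maps out of [G^k] are used because Hom turns
    the cokernel into the solutions of [f M = f], and letting [A] vary recovers the cokernel itself.

    A label is a color together with a homomorphism, so one extension statement per move covers
    colorings (zero homomorphisms) and linear labelings alike. The axioms match the moves:
    idempotence and tau_{x,x} + eta_{x,x} = 1 give the kink, invertibility of right translations and
    of eta gives the bigon, self-distributivity and the three mixed axioms give the triangle. The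
    triangle occurs in sixteen orientation patterns, and the symmetries of the label relation cut
    these down to four.

    Labelings are functions on all natural numbers, but only their values on edges matter; hence
    correspondences are relations, with uniqueness on edges only. *)

Lemma additive_ext (A B : zmodType) (f g : {additive A -> B}) :
  f =1 g -> f = g.
Proof.
case: f g => f [[hf]] [g [[hg]]] /= /funext fg; subst g.
by rewrite (Prop_irrelevance hf hg).
Qed.

Lemma qopK (X : quandle) (x y : X) : (x |> y) |>^-1 y = x.
Proof. by symmetry; apply/qbarP. Qed.

Lemma qbarK (X : quandle) (x y : X) : (x |>^-1 y) |> y = x.
Proof. by symmetry; apply/qbarP. Qed.

Lemma qop_inj (X : quandle) (z : X) : injective (fun x => x |> z).
Proof. by move=> x y /= xyz; rewrite -(qopK x z) xyz qopK. Qed.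

HB.instance Definition _ (X : quandle) (G : zmodType) (m : quandle_module X G)
    (x y : X) :=
  GRing.isZmodMorphism.Build G G (eta_inv m x y) (@eta_invB X G m x y).

Section Labels.
Variables (X : quandle) (G : zmodType) (m : quandle_module X G) (A : zmodType).

Definition label : Type := (X * {additive G -> A})%type.
Implicit Types (u o t b : label) (s : bool).
Local Notation lab x f := (@pair X {additive G -> A} x f).

Lemma label_ext u o : u.1 = o.1 -> u.2 =1 o.2 -> u = o.
Proof. by case: u o => [x f] [y g] /= -> /additive_ext ->. Qed.

(* The homomorphisms transform by the transpose of [(a, b) |-> (alpha a b, b)]. *)
Definition positive u1 u2 o1 o2 : Prop :=
  [/\ o2.1 = o1.1, u2.1 = u1.1 |> o1.1,
      forall g, u1.2 g = u2.2 (eta m u1.1 o1.1 g) &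
      forall g, o1.2 g = o2.2 g + u2.2 (tau m u1.1 o1.1 g)].

(** A negative crossing is the positive relation with incoming and outgoing ends exchanged, just as
    the inverse generator undoes the generator. *)
Definition crossing s u1 u2 o1 o2 : Prop :=
  if s then positive u1 u2 o1 o2 else positive u2 u1 o2 o1.

(** One end of each strand may be prescribed freely, since right translations and eta are invertible
    and the over-strand equation is solved by a subtraction. [bu] and [bo] are true when the
    prescribed end is the incoming one. *)
Lemma positive_exists (bu bo : bool) u o : exists u' o',
  positive (if bu then u else u') (if bu then u' else u)
           (if bo then o else o') (if bo then o' else o).
Proof.
case: u o => [x f] [y h].
case: bu.
  exists (lab (x |> y) (f \o eta_inv m x y)).
  case: bo; [exists (lab y (h \- (f \o eta_inv m x y \o tau m x y)))
            |exists (lab y (h \+ (f \o eta_inv m x y \o tau m x y)))];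
    by split=> // g /=; rewrite ?etaK // subrK.
exists (lab (x |>^-1 y) (f \o eta m (x |>^-1 y) y)).
case: bo; [exists (lab y (h \- (f \o tau m (x |>^-1 y) y)))
          |exists (lab y (h \+ (f \o tau m (x |>^-1 y) y)))];
  by split=> [//||//|g] /=; rewrite ?qbarK // subrK.
Qed.

Lemma crossing_exists s (bu bo : bool) u o : exists u' o',
  crossing s (if bu then u else u') (if bu then u' else u)
             (if bo then o else o') (if bo then o' else o).
Proof.
case: s => /=; first exact: positive_exists.
have [u' [o' P]] := positive_exists (~~ bu) (~~ bo) u o.
by exists u', o'; case: bu bo P => [] [].
Qed.

(** The data are forced in the order over-color, under-color, under-homomorphism, over-homomorphism;
    each is reached from either end of its strand by an invertible operation. *)
Lemma crossing_inj s u1 u2 o1 o2 u1' u2' o1' o2' :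
  crossing s u1 u2 o1 o2 -> crossing s u1' u2' o1' o2' ->
  u1 = u1' \/ u2 = u2' -> o1 = o1' \/ o2 = o2' ->
  [/\ u1 = u1', u2 = u2', o1 = o1' & o2 = o2'].
Proof.
wlog: s u1 u2 o1 o2 u1' u2' o1' o2' / s = true.
  case: s => [|H P P' Eu Eo]; first exact.
  have [|||||-> -> -> ->] // := H true u2 u1 o2 o1 u2' u1' o2' o1'.
    by case: Eu; [right | left].
  by case: Eo; [right | left].
move=> -> [/= E1 E2 E3 E4] [/= E1' E2' E3' E4'] Eu Eo.
have Ey : o1.1 = o1'.1 by case: Eo => [->|Eo] //; rewrite -E1 -E1' Eo.
have Ex : u1.1 = u1'.1.
  case: Eu => [->//|Eu]; apply: (@qop_inj _ o1.1).
  by rewrite /= -E2 Ey -E2' Eu.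
rewrite -Ey -Ex in E1' E2' E3' E4'.
have Eu1 : u1 = u1'.
  by case: Eu => // Eu; apply: label_ext => // g; rewrite E3 E3' Eu.
have Eu2 : u2 = u2'.
  apply: label_ext; first by rewrite E2 E2'.
  by move=> g; rewrite -(eta_invK m u1.1 o1.1 g) -E3 -E3' Eu1.
split => //.
  by case: Eo => // Eo; apply: label_ext => // g; rewrite E4 E4' Eo Eu2.
case: Eo => // Eo; apply: label_ext; first by rewrite E1 E1'.
by move=> g; apply: (addIr (u2.2 (tau m u1.1 o1.1 g))); rewrite -E4 Eu2 -E4' Eo.
Qed.

(** * Kinks and the first Reidemeister move *)

(** Idempotence makes all colors around the kink equal to one [x]; the two homomorphism equations
    then add up to composition with tau_{x,x} + eta_{x,x} = 1. *)
Lemma crossing_kink_over s a e b : crossing s e b a e -> a = b.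
Proof.
case: s => - [/= E1 E2 E3 E4].
  have Eb : b.1 = a.1 by rewrite E2 E1 qopxx.
  apply: label_ext => // g; rewrite E4 E3 E1 -raddfD addrC tau_eta //.
have Eb : e.1 = b.1 by apply: (@qop_inj _ e.1); rewrite /= -E2 qopxx.
apply: label_ext => [|g]; first by rewrite E1.
apply: (addIr (e.2 (tau m b.1 e.1 g))); rewrite -E4 E3 Eb -raddfD.
by rewrite addrC tau_eta.
Qed.

Lemma crossing_kink_under s a e b : crossing s a e e b -> a = b.
Proof.
case: s => - [/= E1 E2 E3 E4].
  have Ea : a.1 = e.1 by apply: (@qop_inj _ e.1); rewrite /= -E2 qopxx.
  apply: label_ext => [|g]; first by rewrite E1.
  apply: (addIr (e.2 (tau m a.1 e.1 g))); rewrite -E4 E3 Ea -raddfD.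
  by rewrite addrC tau_eta.
apply: label_ext => [|g]; first by rewrite E2 E1 qopxx.
by rewrite E4 E3 E1 -raddfD addrC tau_eta.
Qed.

Lemma crossing_kink_over_exists s a : exists e, crossing s e a a e.
Proof.
have [e [e' E]] := crossing_exists s false true a a; rewrite /= in E.
(* Solving the crossing gives one label for each end of the loop; the kink requires these to
   coincide, which is again tau_{x,x} + eta_{x,x} = 1. *)
exists e; suff Ee : e' = e by rewrite Ee in E.
case: s E => - [/= E1 E2 E3 E4].
  have Ee : e.1 = a.1 by apply: (@qop_inj _ a.1); rewrite /= -E2 qopxx.
  apply: label_ext => [|g]; first by rewrite E1.
  apply: (addIr (a.2 (tau m e.1 a.1 g))); rewrite -E4 E3 Ee -raddfD.
  by rewrite addrC tau_eta.
apply: label_ext => [|g]; first by rewrite E2 E1 qopxx.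
by rewrite E4 E3 E1 -raddfD addrC tau_eta.
Qed.

Lemma crossing_kink_under_exists s a : exists e, crossing s a e e a.
Proof.
have [e [e' E]] := crossing_exists s true false a a; rewrite /= in E.
exists e; suff Ee : e' = e by rewrite Ee in E.
case: s E => - [/= E1 E2 E3 E4].
  apply: label_ext => [|g]; first by rewrite E2 -E1 qopxx.
  by rewrite E4 E3 -E1 -raddfD addrC tau_eta.
have Ee : e.1 = a.1 by apply: (@qop_inj _ a.1); rewrite /= -E2 qopxx.
apply: label_ext => [|g]; first by rewrite E1.
apply: (addIr (a.2 (tau m e.1 a.1 g))); rewrite -E4 E3 Ee -raddfD.
by rewrite addrC tau_eta.
Qed.

(** * Triangles and the third Reidemeister move *)

Definition leg_label (first : bool) (t : label * label * label) : label * label :=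
  let: (i, e, o) := t in if first then (i, e) else (e, o).

Definition crossing_legs s (u o : label * label) := crossing s u.1 u.2 o.1 o.2.

Definition triangle_rel s ot om ob (T M B : label * label * label) : Prop :=
  [/\ crossing_legs (s (+) ot (+) om) (leg_label om M) (leg_label ot T),
      crossing_legs (s (+) ot (+) ob) (leg_label ob B) (leg_label (~~ ot) T) &
      crossing_legs (s (+) om (+) ob) (leg_label (~~ ob) B) (leg_label (~~ om) M)].

Definition rev3 (T : label * label * label) := (T.2, T.1.2, T.1.1).

(** Exchanging the ends of every strand changes the type of every crossing, and negating all four
    booleans changes each of the three type formulas accordingly. *)
Lemma triangle_rel_rev s ot om ob T M B :
  triangle_rel s ot om ob T M B ->
  triangle_rel (~~ s) (~~ ot) (~~ om) (~~ ob) (rev3 T) (rev3 M) (rev3 B).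
Proof. by case: T M B s ot om ob => [[? ?] ?] [[? ?] ?] [[? ?] ?] [] [] [] []. Qed.

Definition opp_label u : label := lab u.1 (\- u.2).

Lemma opp_labelK : involutive opp_label.
Proof. by move=> u; apply: label_ext => // g /=; rewrite opprK. Qed.

(* This identifies the label [phi] of a strand with the label [- phi] of the strand
   run backwards, which is what lets the bottom strand of a triangle be reversed. *)
Lemma crossing_opp s u1 u2 o1 o2 :
  crossing s u1 u2 o1 o2 -> crossing (~~ s) (opp_label u2) (opp_label u1) o1 o2.
Proof.
by case: s => - [/= E1 E2 E3 E4]; split=> [||g|g] /=;
  rewrite ?E1 // ?E3 // E4 addrK.
Qed.

Definition opp3 (T : label * label * label) :=
  (opp_label T.2, opp_label T.1.2, opp_label T.1.1).

(** The bottom strand passes under at both of its crossings, so [crossing_opp] applies to both and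
    leaves the top and middle labels untouched. *)
Lemma triangle_rel_opp s ot om ob T M B :
  triangle_rel s ot om ob T M B -> triangle_rel s ot om (~~ ob) T M (opp3 B).
Proof.
case: T M B s ot om ob => [[? ?] ?] [[? ?] ?] [[? ?] ?] [] [] [] [] [P Q S];
  split => //; exact: (crossing_opp Q) || exact: (crossing_opp S).
Qed.

(** Colors match by self-distributivity, and each strand uses one module axiom for its
    homomorphisms: the bottom strand [eta_eta], the middle one [eta_tau], the top one [tau_op]. *)
Lemma triangle_flip_pos (ot om : bool) ti te to mi me mo bi be bo :
  triangle_rel true ot om true (ti, te, to) (mi, me, mo) (bi, be, bo) ->
  exists te' me' be', triangle_rel true (~~ ot) (~~ om) false
    (ti, te', to) (mi, me', mo) (bi, be', bo).
Proof.
case: ti te to mi me mo bi be bo => [xti ti] [xte te] [xto to] [xmi mi]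
  [xme me] [xmo mo] [xbi bi] [xbe be] [xbo bo].
rewrite /triangle_rel /crossing_legs /crossing; case: ot om => [] [] /=.
- case=> - [/= -> -> Em Et] [/= -> -> Eb Et'] [/= -> -> Eb' Em'].
  exists (lab xti (to \+ (mo \o tau m xmi xti))), (lab xmi (mo \o eta m xmi xti)),
    (lab (xbi |> xmi) (bo \o eta m (xbi |> xmi) xti)).
  split; split=> [||g|g] /=; try done.
  + by rewrite -qopD.
  + by rewrite Et Et' Em' Eb' (tau_op m xbi xmi xti) raddfD addrACA.
  + by rewrite Eb Eb' -eta_eta.
  + by rewrite Em Em' -eta_tau.
- case=> - [/= -> -> Em Et] [/= -> Exbe Eb Et'] [/= -> Exbe' Eb' Em'].
  (* [x] is the color forced on the inner bottom edge of the flipped triangle; writing the outer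
     bottom colors in terms of it leaves only products to compare. *)
  have Ebo : xbo = (xbo |>^-1 xte) |> xte by rewrite qbarK.
  move: (xbo |>^-1 xte) Ebo => x Ebo; subst xbo xbe.
  have {Exbe'}Ebi : xbi = x |> xmo.
    by apply: (@qop_inj _ xte); rewrite /= Exbe' -qopD.
  subst xbi.
  exists (lab xte (to \- (mi \o tau m xmo xte))),
    (lab xmo (mi \o eta m xmo xte)), (lab x (bo \o eta m x xte)).
  split; split=> [||g|g] /=; try done.
  + by rewrite subrK.
  + apply: (addIr (me (tau m xmo xte g))); rewrite -Et Et' (tau_op m x xmo xte).
    by rewrite raddfD Em' Eb' addrACA subrK.
  + by rewrite Eb Eb' -eta_eta.
  + by rewrite Em Em' Eb eta_tau.
- case=> - [/= -> -> Em Et] [/= -> -> Eb Et'] [/= -> -> Eb' Em'].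
  (* In the flipped triangle [bo] and [mo] must be the inner labels composed with eta, so the inner
     labels are obtained by dividing by eta. *)
  have [bo' Ebo] : exists f : {additive G -> A},
      forall g, bo g = f (eta m (xbe |> xme) xto g).
    exists (bo \o eta_inv m (xbe |> xme) xto) => g.
    by rewrite [RHS]/= etaK.
  have [mo' Emo] : exists f : {additive G -> A},
      forall g, mo g = f (eta m xme xto g).
    exists (mo \o eta_inv m xme xto) => g.
    by rewrite [RHS]/= etaK.
  have Ebi g : bi g = bo' (eta m (xbe |> xto) (xme |> xto) g).
    by rewrite -(eta_invK m xbe xto g) -Eb Eb' Ebo eta_eta.
  have Emi g : mi g = mo' g + bo' (tau m (xbe |> xto) (xme |> xto) g).
    by rewrite -(eta_invK m xme xto g) -Em Em' Ebo Emo eta_tau.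
  exists (lab xto (ti \+ (mo' \o tau m xme xto))), (lab (xme |> xto) mo'),
    (lab ((xbe |> xme) |> xto) bo').
  split; split=> [||g|g] /=; try done.
  + by rewrite Et Et' Ebi Emi (tau_op m xbe xme xto) raddfD addrACA.
  + by rewrite -qopD.
- case=> - [/= -> -> Em Et] [/= -> -> Eb Et'] [/= -> Exbe Eb' Em'].
  subst xbe.
  (* The crossing of bottom and middle in the flipped triangle forces [be'] and [me']; the two
     crossings with the top strand are then verified. *)
  pose t' := tau m (xbo |> xte) (xme |> xte).
  pose be' : {additive G -> A} := bi \o eta m (xbo |> xte) (xme |> xte).
  pose me' : {additive G -> A} := mo \- (bi \o t').
  have Ebo g : bo g = be' (eta m xbo xte g).
    by rewrite Eb' Eb eta_eta.
  have Emo g : mo g = me' g + bi (t' g) by rewrite [me' g]/= subrK.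
  have Emi g : mi g = me' (eta m xme xte g).
    by apply: (addIr (be (tau m xbo xme g))); rewrite -Em' Em Emo Eb eta_tau.
  exists (lab xte (to \- (be' \o tau m xbo xte))), (lab (xme |> xte) me'),
    (lab (xbo |> xte) be').
  split; split=> [||g|g] //=.
  + pose f := eta m (xbo |> xte) (xme |> xte).
    have Eti : te g = ti g + (bi (f (tau m xbo xte g)) + bi (t' (tau m xme xte g))).
      by rewrite Et' (tau_op m xbo xme xte) raddfD.
    apply: (addIr (bi (f (tau m xbo xte g)) + bi (t' (tau m xme xte g)))).
    by rewrite -Eti Et [RHS]addrACA !subrK.
  + by rewrite subrK.
  + by rewrite -qopD.
Qed.

Lemma triangle_flip s ot om ob ti te to mi me mo bi be bo :
  triangle_rel s ot om ob (ti, te, to) (mi, me, mo) (bi, be, bo) ->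
  exists te' me' be', triangle_rel s (~~ ot) (~~ om) (~~ ob)
    (ti, te', to) (mi, me', mo) (bi, be', bo).
Proof.
wlog: ob bi be bo / ob = true => [H|->].
  case: ob => [|/triangle_rel_opp]; first exact: H.
  case/H=> // te' [me' [be']] /triangle_rel_opp.
  by rewrite /opp3 /= !opp_labelK => Q; exists te', me', (opp_label be').
case: s; first exact: triangle_flip_pos.
(* Total reversal makes the sign true but [ob] false; reversing the bottom strand once more restores
   [ob]. *)
case/triangle_rel_rev/triangle_rel_opp/triangle_flip_pos => te' [me' [be']].
move/triangle_rel_opp/triangle_rel_rev; rewrite !negbK /rev3 /opp3 /= !opp_labelK.
by exists te', me', (opp_label be').
Qed.

(** Every crossing of the triangle meets an outer edge of each of its two strands, so [crossing_inj]
    at two crossings fixes all three inner labels. *)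
Lemma triangle_inner_inj s ot om ob ti te to mi me mo bi be bo te' me' be' :
  triangle_rel s ot om ob (ti, te, to) (mi, me, mo) (bi, be, bo) ->
  triangle_rel s ot om ob (ti, te', to) (mi, me', mo) (bi, be', bo) ->
  [/\ te = te', me = me' & be = be'].
Proof.
case=> P1 P2 _ [Q1 Q2 _].
have [Em Et] : me = me' /\ te = te'.
  by case: ot om P1 Q1 {P2 Q2} => [] [] /= P1 Q1;
    case: (crossing_inj P1 Q1) => /=; auto.
subst me' te'; split=> //.
by case: ot ob P2 Q2 {P1 Q1} => [] [] /= P2 Q2;
  case: (crossing_inj P2 Q2) => /=; auto.
Qed.

End Labels.

(** * Invariance under Reidemeister moves *)

Lemma forall_mem_cat (T : eqType) (P : T -> Prop) (s s' : seq T) :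
  (forall x, x \in s ++ s' -> P x) <->
  (forall x, x \in s -> P x) /\ (forall x, x \in s' -> P x).
Proof.
split=> [H|[H H'] x]; last by rewrite mem_cat => /orP[/H|/H'].
by split=> x xs; apply: H; rewrite mem_cat xs ?orbT.
Qed.

Lemma outs_cat D D' : outs (D ++ D') = outs D ++ outs D'.
Proof. by rewrite /outs map_cat flatten_cat map_cat. Qed.

Lemma ins_cat D D' : ins (D ++ D') = ins D ++ ins D'.
Proof. by rewrite /ins map_cat flatten_cat map_cat. Qed.

Lemma mem_labels D p e : p \in D -> e \in labels p -> e \in ins D ++ outs D.
Proof.
move=> pD /flattenP[_ /mapP[a ap ->] ea].
have aD : a \in flatten (map strands D).
  by apply/flattenP; exists (strands p) => //; apply: map_f.
by move: ea; rewrite mem_cat !inE => /orP[] /eqP ->;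
  rewrite map_f // ?orbT.
Qed.

Lemma mem_outs D e : e \in outs D -> exists2 p, p \in D & e \in labels p.
Proof.
case/mapP=> a /flattenP[_ /mapP[p pD ->] ap] ->; exists p => //.
by apply/flattenP; exists [:: a.1; a.2]; rewrite ?map_f // !inE eqxx orbT.
Qed.

Lemma well_formed_uniq D : well_formed D -> uniq (ins D) /\ uniq (outs D).
Proof. by case/andP=> u /perm_uniq ->. Qed.

Lemma mem_ins_edges D e : well_formed D -> (e \in ins D) = (e \in edges D).
Proof. by case/andP=> _ /perm_mem ->. Qed.

Lemma labels_edges D p e :
  well_formed D -> p \in D -> e \in labels p -> e \in edges D.
Proof.
move=> wf pD /(mem_labels pD); rewrite mem_cat => /orP[|//].
by rewrite mem_ins_edges.
Qed.

Lemma edges_relabel f D : edges (relabel f D) = map f (edges D).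
Proof.
by elim: D => //= p D; rewrite /edges /outs /= !map_cat => ->; case: p.
Qed.

(** An edge that both leaves and enters a vertex of [L] has used up both of its ends, so it cannot
    occur in [D]. *)
Lemma well_formed_fresh (N : seq nat) L D p e : well_formed (L ++ D) ->
  {subset N <= ins L} -> {subset N <= outs L} ->
  p \in D -> e \in labels p -> e \notin N.
Proof.
move=> /well_formed_uniq[]; rewrite ins_cat outs_cat !cat_uniq.
move=> /and3P[_ ui _] /and3P[_ uo _] NI NO pD /(mem_labels pD).
rewrite mem_cat => /orP[] eD; apply/negP => eN.
  by case/hasP: ui; exists e => //; apply: NI.
by case/hasP: uo; exists e => //; apply: NO.
Qed.

Ltac split_ands :=
  repeat match goal with H : is_true (_ && _) |- _ => case/andP: H => ? ? end.

Section Transfer.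
Variables (X : quandle) (G : zmodType) (m : quandle_module X G).

Definition piece_rel (A : zmodType) (l : nat -> label X G A) (p : piece) : Prop :=
  match p with
  | Point a => l a.1 = l a.2
  | Crossing s u o => crossing m s (l u.1) (l u.2) (l o.1) (l o.2)
  end.

Definition labeling (A : zmodType) (l : nat -> label X G A) (D : diagram) : Prop :=
  forall p, p \in D -> piece_rel l p.

Lemma eq_piece_rel (A : zmodType) (l l' : nat -> label X G A) p :
  {in labels p, l =1 l'} -> piece_rel l p -> piece_rel l' p.
Proof.
by case: p => [a|s u o] E /=; rewrite !E // !inE eqxx ?orbT.
Qed.

Lemma eq_labeling (A : zmodType) (l l' : nat -> label X G A) D :
  well_formed D -> {in edges D, l =1 l'} -> labeling l D -> labeling l' D.
Proof.
move=> wf E lD p pD; apply: eq_piece_rel (lD p pD) => e ep.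
exact/E/(labels_edges wf pD).
Qed.

Lemma labeling_cat (A : zmodType) (l : nat -> label X G A) D D' :
  labeling l (D ++ D') <-> labeling l D /\ labeling l D'.
Proof. exact: forall_mem_cat. Qed.

Lemma labeling_relabel (A : zmodType) (l : nat -> label X G A) f D :
  labeling l (relabel f D) <-> labeling (l \o f) D.
Proof.
split=> lD p.
  by move=> pD; have := lD _ (map_f _ pD); case: p {pD}.
by case/mapP => q /lD qD ->; case: q qD.
Qed.

Lemma labeling_cons (A : zmodType) (l : nat -> label X G A) p D :
  labeling l (p :: D) <-> piece_rel l p /\ labeling l D.
Proof.
rewrite (labeling_cat l [:: p] D); split=> -[lp lD]; split=> //.
  by apply: lp; rewrite mem_head.
by move=> q; rewrite inE => /eqP ->.
Qed.

Lemma labeling_pair (A : zmodType) (l : nat -> label X G A) p q :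
  labeling l [:: p; q] <-> piece_rel l p /\ piece_rel l q.
Proof. by rewrite !labeling_cons; split=> [[? [? _]]|[? ?]]; do !split. Qed.

(** * Correspondence of labelings under the moves *)

(** [C] pairs the edges that must carry equal labels. It is a relation rather than a map: removing a
    point sends two edges to one, and edges interior to a move have no partner. *)
Definition agree (C : nat -> nat -> Prop) (D D' : diagram) (T : Type)
    (l l' : nat -> T) : Prop :=
  forall e e', e \in edges D -> e' \in edges D' -> C e e' -> l e = l' e'.

Definition half_transfer (C : nat -> nat -> Prop) (D D' : diagram) : Prop :=
  forall (A : zmodType) (l : nat -> label X G A), labeling l D ->
    (exists2 l', labeling l' D' & agree C D D' l l') /\
    (forall l1 l2, labeling l1 D' -> labeling l2 D' ->
      agree C D D' l l1 -> agree C D D' l l2 -> {in edges D', l1 =1 l2}).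

Lemma eq_half_transfer C C' D D' : (forall e e', C' e e' <-> C e e') ->
  half_transfer C D D' -> half_transfer C' D D'.
Proof.
move=> EC H A l lD; have [[l' lD' a] u] := H A l lD.
split; first by exists l' => // e e' eD eD' /EC; apply: a.
move=> l1 l2 lD1 lD2 a1 a2; apply: u => // e e' eD eD' /EC.
  exact: a1.
exact: a2.
Qed.

Definition transfer D D' : Prop :=
  exists2 C, half_transfer C D D' & half_transfer (fun e' e => C e e') D' D.

Lemma transfer_perm D D' : perm_eq D D' -> transfer D D'.
Proof.
move=> pDD'.
have E : edges D =i edges D'.
  by apply: perm_mem; apply/perm_map/perm_flatten/perm_map.
exists (fun e e' => e = e') => A l lD; split.
- by exists l => [p|e e' _ _ ->] //; rewrite -(perm_mem pDD'); apply: lD.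
- by move=> l1 l2 _ _ a1 a2 e eD'; rewrite -(a1 e) -?(a2 e) ?E.
- by exists l => [p|e e' _ _ ->] //; rewrite (perm_mem pDD'); apply: lD.
- by move=> l1 l2 _ _ a1 a2 e eD'; rewrite -(a1 e) -?(a2 e) -?E.
Qed.

Lemma transfer_relabel f D :
  well_formed D -> {in edges D &, injective f} -> transfer D (relabel f D).
Proof.
move=> wf finj; exists (fun e e' => e' = f e) => A l lD; split.
- pose g e' := nth 0%N (edges D) (index e' (map f (edges D))).
  have fK e : e \in edges D -> g (f e) = e.
    move=> eD; have fe : f e \in map f (edges D) by apply: map_f.
    have ge : g (f e) \in edges D by rewrite mem_nth // -(size_map f) index_mem.
    apply: finj => //; rewrite -(nth_map _ 0%N) ?nth_index //.
    by rewrite -(size_map f) index_mem.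
  exists (l \o g) => [|e e' eD _ -> /=]; last by rewrite fK.
  apply/labeling_relabel; apply: eq_labeling lD => // e eD /=.
  by rewrite fK.
- move=> l1 l2 _ _ a1 a2 e' fe; have := fe; rewrite {1}edges_relabel => /mapP[e eD Ee].
  by rewrite -(a1 e) -?(a2 e).
- exists (l \o f); first exact/labeling_relabel.
  by move=> e' e _ _ ->.
- move=> l1 l2 _ _ a1 a2 e eD.
  have fe : f e \in edges (relabel f D) by rewrite edges_relabel map_f.
  by rewrite -(a1 (f e)) -?(a2 (f e)).
Qed.

Lemma transfer_point a b D : well_formed (Point (a, b) :: D) -> a != b ->
  transfer (Point (a, b) :: D) (relabel (fun e => if e == b then a else e) D).
Proof.
move=> wf ab; set f := fun e => _.
have fE e : e \in edges (Point (a, b) :: D) -> f e \in edges (relabel f D).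
  rewrite edges_relabel [in X in X -> _]/edges /outs /= inE =>
    /orP[/eqP->|]; last first.
    exact: map_f.
  (* As [a] enters the point it must also leave some vertex, and since [a] differs from [b] that
     vertex lies in [D]; so the merged edge survives. *)
  have : a \in edges (Point (a, b) :: D).
    by rewrite -mem_ins_edges // /ins /= mem_head.
  rewrite /edges /outs /= inE (negPf ab) /= => /(map_f f).
  by rewrite /f eqxx (negPf ab).
exists (fun e e' => e' = f e) => A l lD; split.
- have [/= lab lD'] := (labeling_cons l _ _).1 lD.
  have lf e : l (f e) = l e by rewrite /f; case: eqP => [->|].
  exists l; last by move=> e e' _ _ ->.
  apply/labeling_relabel => p pD; apply: eq_piece_rel (lD' p pD) => e _.
  by rewrite /= lf.
- move=> l1 l2 _ _ a1 a2 e' fe; have := fe; rewrite {1}edges_relabel => /mapP[e eD Ee].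
  have eD' : e \in edges (Point (a, b) :: D) by rewrite inE eD orbT.
  by rewrite -(a1 e) -?(a2 e).
- exists (l \o f); last by move=> e' e _ _ ->.
  apply/labeling_cons; split; last exact/labeling_relabel.
  by rewrite /= /f eqxx (negPf ab).
- move=> l1 l2 _ _ a1 a2 e eD.
  by rewrite -(a1 (f e)) -?(a2 (f e)) // fE.
Qed.

(* [N] collects the edges interior to the disc where the diagram is modified. *)
Lemma half_transfer_local (N : seq nat) L L' D :
  well_formed (L' ++ D) ->
  (forall e, e \notin N -> (e \in outs L) = (e \in outs L')) ->
  (forall p e, p \in D -> e \in labels p -> e \notin N) ->
  (forall (A : zmodType) (l : nat -> label X G A), labeling l L ->
    exists2 l', labeling l' L' & forall e, e \notin N -> l' e = l e) ->
  (forall (A : zmodType) (l1 l2 : nat -> label X G A),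
    labeling l1 L' -> labeling l2 L' ->
    (forall e, e \in flatten (map labels L') -> e \notin N -> l1 e = l2 e) ->
    forall e, e \in N -> e \in outs L' -> l1 e = l2 e) ->
  half_transfer (fun e e' => e = e' /\ e \notin N) (L ++ D) (L' ++ D).
Proof.
move=> wf' E fresh ex un A l /labeling_cat[lL lD].
have EE e : e \notin N -> (e \in edges (L ++ D)) = (e \in edges (L' ++ D)).
  by move=> eN; rewrite /edges !outs_cat !mem_cat E.
split.
  have [l' lL' El'] := ex A l lL; exists l'; last first.
    by move=> e _ _ _ [<- eN]; rewrite El'.
  apply/labeling_cat; split=> // p pD; apply: eq_piece_rel (lD p pD) => e ep.
  by rewrite El' // (fresh p).
move=> l1 l2 /labeling_cat[lL1 _] /labeling_cat[lL2 _] a1 a2.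
have a12 e : e \notin N -> e \in edges (L' ++ D) -> l1 e = l2 e.
  by move=> eN eL; rewrite -(a1 e) -?(a2 e) ?EE.
move=> e eD; have [eN|/a12 ->//] := boolP (e \in N).
apply: (un A) => //.
  move=> e' /flattenP[_ /mapP[p pL' ->] e'p] e'N; apply: a12 => //.
  by apply: (labels_edges (p := p)); rewrite // mem_cat pL'.
move: eD; rewrite /edges outs_cat mem_cat => /orP[//|] /mem_outs[p pD ep].
by rewrite (negPf (fresh p e pD ep)) in eN.
Qed.

Lemma transfer_local (N : seq nat) L L' D :
  well_formed (L ++ D) -> well_formed (L' ++ D) ->
  {subset N <= ins L'} -> {subset N <= outs L'} ->
  (forall e, e \notin N -> (e \in outs L) = (e \in outs L')) ->
  (forall (A : zmodType) (l : nat -> label X G A), labeling l L ->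
    exists2 l', labeling l' L' & forall e, e \notin N -> l' e = l e) ->
  (forall (A : zmodType) (l : nat -> label X G A), labeling l L' ->
    exists2 l', labeling l' L & forall e, e \notin N -> l' e = l e) ->
  (forall (A : zmodType) (l1 l2 : nat -> label X G A),
    labeling l1 L -> labeling l2 L ->
    (forall e, e \in flatten (map labels L) -> e \notin N -> l1 e = l2 e) ->
    forall e, e \in N -> e \in outs L -> l1 e = l2 e) ->
  (forall (A : zmodType) (l1 l2 : nat -> label X G A),
    labeling l1 L' -> labeling l2 L' ->
    (forall e, e \in flatten (map labels L') -> e \notin N -> l1 e = l2 e) ->
    forall e, e \in N -> e \in outs L' -> l1 e = l2 e) ->
  transfer (L ++ D) (L' ++ D).
Proof.
move=> wf wf' NI NO E ex ex' un un'.
have fresh p e := @well_formed_fresh N L' D p e wf' NI NO.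
exists (fun e e' => e = e' /\ e \notin N); first exact: half_transfer_local.
apply: eq_half_transfer (half_transfer_local wf _ fresh ex' un).
  by move=> e e'; split=> -[-> ?].
by move=> e eN; rewrite E.
Qed.

(** Uniqueness of the ends of edges makes [e] distinct from [a] and [b]. The case [a = b], a kink on
    a closed circle, is included. *)
Lemma transfer_kink s (over_first : bool) a e b D :
  well_formed (Point (a, b) :: D) -> well_formed (kink s over_first a e b :: D) ->
  transfer (Point (a, b) :: D) (kink s over_first a e b :: D).
Proof.
move=> wf wf'; have [ui uo] := well_formed_uniq wf'.
have ea : e != a.
  by case: over_first ui {wf' uo}; rewrite /ins /= !inE negb_or 1?eq_sym =>
    /andP[/andP[]].
have eb : e != b.
  by case: over_first uo {wf' ui}; rewrite /outs /= !inE negb_or 1?eq_sym =>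
    /andP[/andP[]].
apply: (@transfer_local [:: e] [:: Point (a, b)] [:: kink s over_first a e b]) => //.
- by move=> x; rewrite inE => /eqP->; case: over_first {wf wf' ui uo};
    rewrite /ins /= !inE eqxx ?orbT.
- by move=> x; rewrite inE => /eqP->; case: over_first {wf wf' ui uo};
    rewrite /outs /= !inE eqxx ?orbT.
- by move=> x; rewrite inE => /negPf xe; case: over_first {wf wf' ui uo};
    rewrite /outs /= !inE xe ?orbF.
- move=> A l /labeling_cons[/= lab _].
  have [t Ht] : exists t, if over_first then crossing m s t (l b) (l a) t
      else crossing m s (l a) t t (l b).
    rewrite lab; case: over_first {wf wf' ui uo}.
      exact: crossing_kink_over_exists.
    exact: crossing_kink_under_exists.
  exists (fun x => if x == e then t else l x); last first.
    by move=> x; rewrite inE => /negPf ->.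
  apply/labeling_cons; split=> //.
  by case: over_first Ht {wf wf' ui uo}; rewrite /= eqxx ![_ == e]eq_sym
    (negPf ea) (negPf eb).
- move=> A l /labeling_cons[/= le _]; exists l => //.
  apply/labeling_cons; split=> //=.
  case: over_first le {wf wf' ui uo} => /=; first exact: crossing_kink_over.
  exact: crossing_kink_under.
- move=> A l1 l2 _ _ _ x; rewrite inE => /eqP ->.
  by rewrite /outs /= inE (negPf eb).
- move=> A l1 l2 /labeling_cons[/= le1 _] /labeling_cons[/= le2 _] E x.
  rewrite inE => /eqP -> _.
  have {}E y : y \in [:: a; b] -> l1 y = l2 y.
    rewrite !inE => yab; apply: E.
      by case: over_first {wf wf' ui uo le1 le2}; rewrite /= !inE;
        case/orP: yab => /eqP ->; rewrite eqxx ?orbT.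
    by case/orP: yab => /eqP ->; rewrite inE eq_sym.
  have Ea : l1 a = l2 a by apply: E; rewrite mem_head.
  have Eb : l1 b = l2 b by apply: E; rewrite !inE eqxx orbT.
  case: over_first le1 le2 {wf wf' ui uo E} => /= le1 le2;
    by case: (crossing_inj le1 le2); auto.
Qed.

Lemma crossing_negb (A : zmodType) s (u1 u2 o1 o2 : label X G A) :
  crossing m (~~ s) u1 u2 o1 o2 = crossing m s u2 u1 o2 o1.
Proof. by case: s. Qed.

(** By [crossing_negb] the second crossing imposes the relation of the first with the ends
    exchanged. Solving one therefore solves both, and conversely the shared inner edges force the
    outer labels to agree by [crossing_inj]. *)
Lemma transfer_bigon s (parallel : bool) a e b c f d D :
  well_formed (Point (a, b) :: Point (c, d) :: D) ->
  well_formed (bigon s parallel a e b c f d ++ D) ->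
  transfer (Point (a, b) :: Point (c, d) :: D) (bigon s parallel a e b c f d ++ D).
Proof.
move=> wf wf'; have [ui uo] := well_formed_uniq wf'.
have [ea ec fa fc] : [/\ e != a, e != c, f != a & f != c].
  by case: parallel ui {wf' uo}; rewrite /ins /= !inE !negb_or;
    move=> ?; split_ands; split; rewrite // eq_sym.
have [eb ed fb fd ef] : [/\ e != b, e != d, f != b, f != d & e != f].
  by case: parallel uo {wf' ui}; rewrite /outs /= !inE !negb_or;
    move=> ?; split_ands; split; rewrite // eq_sym.
have ne (x y : nat) : x != y -> (y == x) = false by rewrite eq_sym => /negPf.
have neE := (ne _ _ ea, ne _ _ ec, ne _ _ fa, ne _ _ fc, ne _ _ eb, ne _ _ ed,
  ne _ _ fb, ne _ _ fd, ne _ _ ef).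
apply: (@transfer_local [:: e; f] [:: Point (a, b); Point (c, d)]) => //.
- by move=> x; rewrite !inE => /orP[]/eqP->; case: parallel {wf wf' ui uo};
    rewrite /ins /= !inE eqxx ?orbT.
- by move=> x; rewrite !inE => /orP[]/eqP->; case: parallel {wf wf' ui uo};
    rewrite /outs /= !inE eqxx ?orbT.
- by move=> x; rewrite !inE negb_or => /andP[/negPf xe /negPf xf];
    case: parallel {wf wf' ui uo};
    rewrite /outs /= !inE xe xf ?orbF //= orbC.
- move=> A l /labeling_pair[/= lab lcd].
  have [u [o P]] := crossing_exists m s true parallel (l a) (l c).
  exists (fun x => if x == e then u else if x == f then o else l x); last first.
    by move=> x; rewrite !inE negb_or => /andP[/negPf -> /negPf ->].
  case: parallel P {wf wf' ui uo} => /= P.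
    apply/labeling_pair; split=> /=; rewrite ?crossing_negb;
      by rewrite !eqxx !neE -?lab -?lcd.
  apply/labeling_pair; split=> /=; rewrite ?crossing_negb;
    by rewrite !eqxx !neE -?lab -?lcd.
- move=> A l lb; exists l => //.
  case: parallel lb {wf wf' ui uo} =>
    /labeling_pair[/= P]; rewrite crossing_negb => Q.
    have [] := crossing_inj P Q; auto => Ea _ Ec _.
    by apply/labeling_pair; split=> /=.
  have [] := crossing_inj P Q; auto => Ea _ Ec Ed.
  by apply/labeling_pair; split=> /=.
- move=> A l1 l2 _ _ _ x; rewrite !inE => /orP[]/eqP->;
    by rewrite ?(negPf eb) ?(negPf ed) ?(negPf fb) ?(negPf fd).
- move=> A l1 l2 H1 H2 E x xN _.
  have {}E y : y \in [:: a; b; c; d] -> l1 y = l2 y.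
    rewrite !inE => yN; apply: E; last first.
      by case/or4P: yN => /eqP ->; rewrite !inE !neE.
    by case: parallel {wf wf' ui uo H1 H2}; case/or4P: yN => /eqP ->;
      rewrite /= !inE eqxx ?orbT.
  have Ea : l1 a = l2 a by apply: E; rewrite !inE eqxx.
  have Ec : l1 c = l2 c by apply: E; rewrite !inE eqxx !orbT.
  have Ed : l1 d = l2 d by apply: E; rewrite !inE eqxx !orbT.
  have [Ee Ef] : l1 e = l2 e /\ l1 f = l2 f.
    case: parallel H1 H2 {wf wf' ui uo} =>
      /labeling_cons[/= P _] /labeling_cons[/= Q _];
      by have [] := crossing_inj P Q; auto.
  by move: xN; rewrite !inE => /orP[]/eqP->.
Qed.
Lemma labeling_triangle (A : zmodType) (l : nat -> label X G A) s ot om ob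
    ti te to mi me mo bi be bo :
  labeling l (triangle s ot om ob (ti, te, to) (mi, me, mo) (bi, be, bo)) <->
  triangle_rel m s ot om ob (l ti, l te, l to) (l mi, l me, l mo) (l bi, l be, l bo).
Proof.
rewrite /triangle labeling_cons labeling_pair /triangle_rel /crossing_legs.
by case: ot om ob => [] [] []; split=> -[P] => [[]|] => Q R; do !split.
Qed.

Lemma outs_triangle s ot om ob ti te to mi me mo bi be bo :
  perm_eq (outs (triangle s ot om ob (ti, te, to) (mi, me, mo) (bi, be, bo)))
          [:: te; me; be; to; mo; bo].
Proof.
by apply/permP=> P; case: ot om ob => [] [] []; rewrite /outs /=; lia.
Qed.

Lemma ins_triangle s ot om ob ti te to mi me mo bi be bo :
  perm_eq (ins (triangle s ot om ob (ti, te, to) (mi, me, mo) (bi, be, bo)))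
          [:: te; me; be; ti; mi; bi].
Proof.
by apply/permP=> P; case: ot om ob => [] [] []; rewrite /ins /=; lia.
Qed.

Lemma transfer_triangle s ot om ob (t q b : nat * nat * nat) D :
  well_formed (triangle s ot om ob t q b ++ D) ->
  well_formed (triangle s (~~ ot) (~~ om) (~~ ob) t q b ++ D) ->
  transfer (triangle s ot om ob t q b ++ D)
           (triangle s (~~ ot) (~~ om) (~~ ob) t q b ++ D).
Proof.
case: t q b => [[ti te] to] [[mi me] mo] [[bi be] bo] wf wf'.
have [] := well_formed_uniq wf; rewrite ins_cat outs_cat !cat_uniq.
rewrite (perm_uniq (ins_triangle _ _ _ _ _ _ _ _ _ _ _ _ _)).
rewrite (perm_uniq (outs_triangle _ _ _ _ _ _ _ _ _ _ _ _ _)).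
move=> /andP[ui _] /andP[uo _].
(* Since negation is an involution, keeping the booleans general lets this one statement serve both
   directions of the move. *)
have ex (u1 u2 u3 : bool) (A : zmodType) (l : nat -> label X G A) :
    labeling l (triangle s u1 u2 u3 (ti, te, to) (mi, me, mo) (bi, be, bo)) ->
    exists2 l', labeling l' (triangle s (~~ u1) (~~ u2) (~~ u3)
                              (ti, te, to) (mi, me, mo) (bi, be, bo)) &
      forall e, e \notin [:: te; me; be] -> l' e = l e.
  move/labeling_triangle/triangle_flip => [te' [me' [be' H]]].
  exists (fun x => if x == te then te' else if x == me then me' else
                   if x == be then be' else l x); last first.
    by move=> x; rewrite !inE !negb_or => /and3P[/negPf-> /negPf-> /negPf->].
  apply/labeling_triangle; move: ui uo; rewrite /= !inE !negb_or => ui uo.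
  split_ands; rewrite !eqxx.
  by do ![rewrite ifN_eqC; [|by []]].
have un (u1 u2 u3 : bool) (A : zmodType) (l1 l2 : nat -> label X G A) :
    labeling l1 (triangle s u1 u2 u3 (ti, te, to) (mi, me, mo) (bi, be, bo)) ->
    labeling l2 (triangle s u1 u2 u3 (ti, te, to) (mi, me, mo) (bi, be, bo)) ->
    (forall e, e \in flatten (map labels
         (triangle s u1 u2 u3 (ti, te, to) (mi, me, mo) (bi, be, bo))) ->
       e \notin [:: te; me; be] -> l1 e = l2 e) ->
    forall e, e \in [:: te; me; be] -> l1 e = l2 e.
  move=> /labeling_triangle H1 /labeling_triangle H2 E x xN.
  have {}E y : y \in [:: ti; to; mi; mo; bi; bo] -> l1 y = l2 y.
    move=> yN; apply: E.
      move: yN; rewrite !inE => yN.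
      by case: u1 u2 u3 {H1 H2} => [] [] []; rewrite /= ?inE;
        do ![case/orP: yN => [/eqP->|yN]]; rewrite ?(eqP yN) eqxx ?orbT.
    move: ui uo yN; rewrite /= !inE !negb_or => ui uo yN; split_ands.
    by do ![case/orP: yN => [/eqP->|yN]]; rewrite ?(eqP yN); apply/and3P;
      split=> //; rewrite eq_sym.
  move: H2; rewrite -(E ti) -?(E to) -?(E mi) -?(E mo) -?(E bi) -?(E bo)
    ?inE ?eqxx ?orbT // => /(triangle_inner_inj H1)[Et Em Eb].
  by move: xN; rewrite !inE => /or3P[] /eqP->.
apply: (@transfer_local [:: te; me; be]) => //.
- move=> x; rewrite (perm_mem (ins_triangle _ _ _ _ _ _ _ _ _ _ _ _ _)).
  by rewrite !inE => /or3P[]/eqP->; rewrite eqxx ?orbT.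
- move=> x; rewrite (perm_mem (outs_triangle _ _ _ _ _ _ _ _ _ _ _ _ _)).
  by rewrite !inE => /or3P[]/eqP->; rewrite eqxx ?orbT.
- by move=> x _; rewrite !(perm_mem (outs_triangle _ _ _ _ _ _ _ _ _ _ _ _ _)).
- exact: ex.
- by move=> A l /ex; rewrite !negbK.
- by move=> A l1 l2 H1 H2 E x xN _; apply: un H1 H2 E x xN.
- by move=> A l1 l2 H1 H2 E x xN _; apply: un H1 H2 E x xN.
Qed.

Lemma reidemeister_transfer D D' :
  well_formed D -> well_formed D' -> reidemeister D D' -> transfer D D'.
Proof.
move=> wf wf' R; case: R wf wf' => {D D'}.
- by move=> D D' p _ _; apply: transfer_perm.
- by move=> f D finj wf _; apply: transfer_relabel.
- by move=> a b D ab wf _; apply: transfer_point.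
- by move=> *; apply: transfer_kink.
- by move=> *; apply: transfer_bigon.
- by move=> *; apply: transfer_triangle.
Qed.

(** * Colorings, universal labelings and their invariance *)

Definition piece_coloring (x : nat -> X) (p : piece) : Prop :=
  match p with
  | Point a => x a.1 = x a.2
  | Crossing s u o => x o.2 = x o.1 /\
      if s then x u.2 = x u.1 |> x o.1 else x u.1 = x u.2 |> x o.1
  end.

Definition coloring (x : nat -> X) (D : diagram) : Prop :=
  forall p, p \in D -> piece_coloring x p.

Definition with_hom (A : zmodType) (x : nat -> X) (phi : nat -> {additive G -> A}) :
    nat -> label X G A := fun e => (x e, phi e).

Lemma labeling_coloring (A : zmodType) (l : nat -> label X G A) D :
  labeling l D -> coloring (fun e => (l e).1) D.
Proof.
move=> lD p /lD; case: p => [a /= -> //|[] u o /= [E1 E2 _ _]] //.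
by rewrite E1.
Qed.

(** Zero homomorphisms satisfy every crossing equation; through them, extension and uniqueness of
    colorings become special cases of those for labelings. *)
Lemma coloring_labeling (x : nat -> X) D :
  coloring x D -> labeling (with_hom x (fun=> \0 : {additive G -> G})) D.
Proof.
move=> xD p /xD; case: p => [a /= E|[] u o /= [E1 E2]].
- by rewrite /with_hom E.
- by split=> //= g; rewrite addr0.
- by split=> [||g|g] //=; rewrite ?E1 // addr0.
Qed.

(* [Q] carries a universal family of linear labels over the coloring [x]: it
   represents the functor [A |-> {linear labels over x with values in A}]. *)
Definition universal (D : diagram) (x : nat -> X) (Q : zmodType) : Prop :=
  exists u : nat -> {additive G -> Q}, [/\ labeling (with_hom x u) D,
    forall (A : zmodType) (phi : nat -> {additive G -> A}),
      labeling (with_hom x phi) D ->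
      exists h : {additive Q -> A}, {in edges D, forall e, phi e =1 h \o u e} &
    forall (A : zmodType) (h h' : {additive Q -> A}),
      {in edges D, forall e, h \o u e =1 h' \o u e} -> h =1 h'].

Lemma universal_iso D x Q Q' :
  universal D x Q -> universal D x Q' -> zmod_isomorphic Q Q'.
Proof.
move=> [u [lu exu unu]] [v [lv exv unv]].
have [f Ef] := exu _ _ lv; have [g Eg] := exv _ _ lu.
exists f; exists g.
  apply: (unu _ (g \o f) idfun) => e eD a /=.
  by have /= <- := Ef e eD a; have /= <- := Eg e eD a.
apply: (unv _ (f \o g) idfun) => e eD a /=.
by have /= <- := Eg e eD a; have /= <- := Ef e eD a.
Qed.

Lemma labeling_comp (A B : zmodType) x (phi : nat -> {additive G -> A})
    (h : {additive A -> B}) D :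
  labeling (with_hom x phi) D ->
  labeling (with_hom x (fun e => h \o phi e : {additive G -> B})) D.
Proof.
move=> lD p /lD; case: p => [a /= [E1 E2]|[] u o /=].
- by rewrite /with_hom E1 E2.
- by case=> /= E1 E2 E3 E4; split=> //= g; rewrite ?E3 // E4 raddfD.
- by case=> /= E1 E2 E3 E4; split=> //= g; rewrite ?E3 // E4 raddfD.
Qed.

(** The first four clauses make [R] a bijection of colorings up to values off the edges; the last
    lets the same groups represent the linear labelings over corresponding colorings. *)
Definition equivalent (D D' : diagram) : Prop :=
  exists R : (nat -> X) -> (nat -> X) -> Prop,
    [/\ forall x x', R x x' -> coloring x D /\ coloring x' D',
        forall x, coloring x D -> exists x', R x x',
        forall x', coloring x' D' -> exists x, R x x',
        forall x1 x1' x2 x2', R x1 x1' -> R x2 x2' ->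
          ({in edges D, x1 =1 x2} <-> {in edges D', x1' =1 x2'}) &
        forall x x' Q, R x x' -> (universal D x Q <-> universal D' x' Q)].

Lemma equivalent_refl D : equivalent D D.
Proof.
exists (fun x x' => coloring x D /\ x = x'); split.
- by move=> x _ [xD <-].
- by move=> x xD; exists x.
- by move=> x xD; exists x.
- by move=> x1 _ x2 _ [_ <-] [_ <-].
- by move=> x _ Q [_ <-].
Qed.

Lemma equivalent_sym D D' : equivalent D D' -> equivalent D' D.
Proof.
case=> R [R1 R2 R3 R4 R5]; exists (fun x' x => R x x'); split=> //.
- by move=> x' x /R1[].
- by move=> x1' x1 x2' x2 r1 r2; rewrite (R4 _ _ _ _ r1 r2).
- by move=> x' x Q r; rewrite (R5 _ _ _ r).
Qed.

Lemma equivalent_trans D D' D'' :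
  equivalent D D' -> equivalent D' D'' -> equivalent D D''.
Proof.
case=> R [R1 R2 R3 R4 R5] [S [S1 S2 S3 S4 S5]].
exists (fun x x'' => exists2 x', R x x' & S x' x''); split.
- by move=> x x'' [x' /R1[? _] /S1[]].
- by move=> x /R2[x' r]; have [_ /S2[x'' s]] := R1 _ _ r; exists x'', x'.
- by move=> x'' /S3[x' s]; have [/R3[x r] _] := S1 _ _ s; exists x, x'.
- move=> x1 x1'' x2 x2'' [x1' r1 s1] [x2' r2 s2].
  by rewrite (R4 _ _ _ _ r1 r2) (S4 _ _ _ _ s1 s2).
- by move=> x x'' Q [x' r s]; rewrite (R5 _ _ _ r) (S5 _ _ _ s).
Qed.

Lemma agree_with_hom (A : zmodType) C D D' x x' (phi phi' : nat -> {additive G -> A}) :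
  agree C D D' x x' -> agree C D D' phi phi' ->
  agree C D D' (with_hom x phi) (with_hom x' phi').
Proof.
by move=> a b e e' eD eD' c; rewrite /with_hom (a _ _ eD eD' c) (b _ _ eD eD' c).
Qed.

Lemma agree_swap C D D' T (l l' : nat -> T) :
  agree C D D' l l' <-> agree (fun e' e => C e e') D' D l' l.
Proof. by split=> al e e' eD eD' c; symmetry; apply: al. Qed.

Lemma half_transfer_coloring C D D' x : half_transfer C D D' -> coloring x D ->
  exists2 x', coloring x' D' & agree C D D' x x'.
Proof.
move=> H xD; have [[l lD' al] _] := H _ _ (coloring_labeling xD).
exists (fun e => (l e).1); first exact: labeling_coloring.
by move=> e e' eD eD' c; rewrite -(al e e').
Qed.

Lemma half_transfer_coloring_inj C D D' x x1 x2 :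
  half_transfer C D D' -> coloring x D -> coloring x1 D' -> coloring x2 D' ->
  agree C D D' x x1 -> agree C D D' x x2 -> {in edges D', x1 =1 x2}.
Proof.
move=> H xD x1D x2D a1 a2 e eD'.
have [_ U] := H _ _ (coloring_labeling xD).
suff: with_hom x1 (fun=> \0 : {additive G -> G}) e = with_hom x2 (fun=> \0) e by case.
by apply: (U _ _ (coloring_labeling x1D) (coloring_labeling x2D)) => //;
  apply: agree_with_hom.
Qed.

Lemma half_transfer_hom C D D' x x' (A : zmodType) (phi : nat -> {additive G -> A}) :
  well_formed D' -> half_transfer C D D' -> coloring x D -> coloring x' D' ->
  agree C D D' x x' -> labeling (with_hom x phi) D ->
  exists2 phi' : nat -> {additive G -> A},
    labeling (with_hom x' phi') D' & agree C D D' phi phi'.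
Proof.
move=> wf' H xD xD' a lphi; have [[l lD' al] _] := H _ _ lphi.
have lx : {in edges D', (fun e => (l e).1) =1 x'}.
  apply: (half_transfer_coloring_inj H xD (labeling_coloring lD') xD') => //.
  by move=> e e' eD eD' c; rewrite -(al e e').
exists (fun e => (l e).2); last by move=> e e' eD eD' c; rewrite -(al e e').
apply: (eq_labeling wf') lD' => e eD'.
by rewrite /with_hom -lx //; case: (l e).
Qed.

Lemma half_transfer_hom_inj C D D' x x' (A : zmodType)
    (phi phi1 phi2 : nat -> {additive G -> A}) :
  half_transfer C D D' -> agree C D D' x x' -> labeling (with_hom x phi) D ->
  labeling (with_hom x' phi1) D' -> labeling (with_hom x' phi2) D' ->
  agree C D D' phi phi1 -> agree C D D' phi phi2 ->
  {in edges D', phi1 =1 phi2}.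
Proof.
move=> H a lD l1 l2 a1 a2 e eD'; have [_ U] := H _ _ lD.
suff: with_hom x' phi1 e = with_hom x' phi2 e by case.
by apply: (U _ _ l1 l2) => //; apply: agree_with_hom.
Qed.

(** The universal family is carried across the move. A labeling of [D'] is carried back, factored
    over [D], and the factorization holds on [D'] because extensions from [D] are unique. *)
Lemma half_transfer_universal C D D' x x' Q :
  well_formed D -> well_formed D' ->
  half_transfer C D D' -> half_transfer (fun e' e => C e e') D' D ->
  coloring x D -> coloring x' D' -> agree C D D' x x' ->
  universal D x Q -> universal D' x' Q.
Proof.
move=> wf wf' H H' xD xD' a [u [lu exu unu]].
have a' := (agree_swap C D D' x x').1 a.
have agree_comp (A B : zmodType) (h : {additive A -> B})
    (phi phi' : nat -> {additive G -> A}) :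
    agree C D D' phi phi' ->
    agree C D D' (fun e => h \o phi e : {additive G -> B})
                 (fun e => h \o phi' e : {additive G -> B}).
  by move=> ap e e' eD eD' c; rewrite (ap _ _ eD eD' c).
have [u' lu' au] := half_transfer_hom wf' H xD xD' a lu; exists u'; split=> //.
- move=> A phi' lphi'.
  have [phi lphi /agree_swap/= aphi] := half_transfer_hom wf H' xD' xD a' lphi'.
  have [h Eh] := exu _ _ lphi; exists h => e eD' g.
  rewrite (half_transfer_hom_inj H a lphi lphi' (labeling_comp h lu')) //.
  move=> e1 e2 e1D e2D c; rewrite -(agree_comp _ _ h _ _ au e1 e2) //.
  by apply: additive_ext => b; rewrite Eh.
- move=> A h h' E; apply: unu => e eD g.
  have := half_transfer_hom_inj H' a' (labeling_comp h lu') (labeling_comp h lu)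
    (labeling_comp h' lu) _ _ eD.
  move=> EE; suff: (h \o u e : {additive G -> A}) = (h' \o u e : {additive G -> A}).
    by move/(congr1 (fun f : {additive G -> A} => f g)).
  apply: EE; apply/agree_swap; first exact: agree_comp.
  move=> e1 e2 e1D e2D c; rewrite (agree_comp _ _ h' _ _ au e1 e2 e1D e2D c).
  by apply: additive_ext => b; rewrite [RHS]E.
Qed.

Lemma transfer_equivalent D D' :
  well_formed D -> well_formed D' -> transfer D D' -> equivalent D D'.
Proof.
move=> wf wf' [C H H'].
exists (fun x x' => [/\ coloring x D, coloring x' D' & agree C D D' x x']).
split.
- by move=> x x' [].
- by move=> x xD; have [x' xD' a] := half_transfer_coloring H xD; exists x'.
- move=> x' xD'; have [x xD a] := half_transfer_coloring H' xD'.
  by exists x; split=> //; apply/agree_swap.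
- move=> x1 x1' x2 x2' [l1 l1' a1] [l2 l2' a2]; split=> E.
    apply: (half_transfer_coloring_inj H l1 l1' l2') => //.
    by move=> e1 e2 e1D e2D c; rewrite E // (a2 e1 e2).
  apply: (half_transfer_coloring_inj H' l1' l1 l2); apply/agree_swap => //.
  by move=> e1 e2 e1D e2D c; rewrite E // (a2 e1 e2).
- move=> x x' Q [xD xD' a]; split; first exact: (half_transfer_universal wf wf' H H').
  by apply: (half_transfer_universal wf' wf H' _ xD' xD _); last exact/agree_swap.
Qed.

Lemma same_link_equivalent D D' : same_link D D' -> equivalent D D'.
Proof.
elim=> {D D'} [D D' [/andP[wf _] /andP[wf' _] R]|D|D D' _|D D' D'' _ E _].
- exact/transfer_equivalent/reidemeister_transfer.
- exact: equivalent_refl.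
- exact: equivalent_sym.
- exact: equivalent_trans E.
Qed.
End Transfer.

(** This serves the empty quandle, for which a braid on zero strings has one coloring and any other
    braid has none. A single point with distinct ends is not well formed, so merging its edges never
    erases a whole diagram. *)
Lemma same_link_nil D D' : same_link D D' -> (D == [::]) = (D' == [::]).
Proof.
elim=> {D D'} // [D D' [/andP[wf _] _ R]|D D' D'' _ -> _ ->] //.
case: R wf => {D D'} //.
- by move=> D D' /perm_size; case: D D' => [|? ?] [|? ?].
- by move=> f [|p D].
- move=> a b [|p D] // ab /andP[_ /perm_mem/(_ a)].
  by rewrite !inE eqxx (negPf ab).
- by move=> s [] a e b c f d D.
Qed.

(** * Closures of braids *)

Section Closure.
Variables (X : quandle) (G : zmodType) (m : quandle_module X G) (k : nat).
Implicit Types (w : braid_word k) (l : letter k).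

Definition row_of (T : Type) (x : nat -> T) (j : nat) : {ffun 'I_k -> T} :=
  [ffun i : 'I_k => x (j * k + i)%N].

Lemma act_cat (Q : quandle) w1 w2 (r : {ffun 'I_k -> Q}) :
  act (w1 ++ w2) r = act w1 (act w2 r).
Proof. by rewrite /act foldr_cat. Qed.

Lemma braid_map_cat w1 w2 x a :
  braid_map m (w1 ++ w2) x a = braid_map m w1 (act w2 x) (braid_map m w2 x a).
Proof. by apply/ffunP => i; rewrite !ffunE act_cat act_vpair. Qed.

Lemma level_cases (P : piece -> Prop) l j :
  (forall p, p \in level l j -> P p) <->
  P (if l.2 then Crossing true ((j * k + lo l.1)%N, (j.+1 * k + hi l.1)%N)
                               ((j * k + hi l.1)%N, (j.+1 * k + lo l.1)%N)
     else Crossing false ((j * k + hi l.1)%N, (j.+1 * k + lo l.1)%N)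
                         ((j * k + lo l.1)%N, (j.+1 * k + hi l.1)%N)) /\
  (forall n : 'I_k, n != lo l.1 -> n != hi l.1 ->
     P (Point ((j * k + n)%N, (j.+1 * k + n)%N))).
Proof.
split=> [H|[H H'] p].
  split=> [|n nlo nhi]; first exact/H/mem_head.
  apply: H; rewrite inE; apply/orP; right; apply: (map_f (fun n => _)).
  by rewrite mem_filter mem_iota /= ltn_ord andbT; apply/andP.
rewrite inE => /orP[/eqP -> //|/mapP[n]].
rewrite mem_filter mem_iota add0n => /andP[/andP[nlo nhi] /= nk] ->.
exact: (H' (Ordinal nk)).
Qed.

Lemma lo_neq_hi (i : 'I_k.-1) : (lo i == hi i) = false.
Proof. by apply/eqP => /(congr1 val) /= /eqP; rewrite eqn_leq ltnn andbF. Qed.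

Lemma coloring_level (x : nat -> X) l j :
  coloring x (level l j) <-> row_of x j.+1 = act_letter l (row_of x j).
Proof.
rewrite /coloring level_cases; case: l => i [] /=; split.
- case=> -[E1 E2] E; apply/ffunP => n; rewrite !ffunE.
  case: (eqVneq n (lo i)) => [->|nlo]; first by rewrite E1.
  by case: (eqVneq n (hi i)) => [->|nhi]; rewrite ?E2 // -E.
- move=> E; have {}E n := congr1 (fun f : {ffun 'I_k -> X} => f n) E.
  split=> [|n nlo nhi].
    have := E (hi i); have := E (lo i); rewrite !ffunE !eqxx.
    by rewrite eq_sym lo_neq_hi.
  by have := E n; rewrite !ffunE (negPf nlo) (negPf nhi).
- case=> -[E1 /qbarP E2] E; apply/ffunP => n; rewrite !ffunE.
  case: (eqVneq n (lo i)) => [->|nlo]; first by rewrite E2.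
  by case: (eqVneq n (hi i)) => [->|nhi]; rewrite ?E1 // -E.
- move=> E; have {}E n := congr1 (fun f : {ffun 'I_k -> X} => f n) E.
  split=> [|n nlo nhi].
    have := E (hi i); have := E (lo i); rewrite !ffunE !eqxx.
    by rewrite eq_sym lo_neq_hi => /qbarP.
  by have := E n; rewrite !ffunE (negPf nlo) (negPf nhi).
Qed.

(** Levels are indexed by factorizations of the word: the suffix [w2] is the part of the braid below
    the letter, and its length is the height. *)
Lemma braid_diagram_cases (P : piece -> Prop) w :
  (forall p, p \in braid_diagram w -> P p) <->
  forall w1 l w2, w = w1 ++ l :: w2 -> forall p, p \in level l (size w2) -> P p.
Proof.
elim: w => [|l w IH]; first by split=> // _ [].
rewrite (forall_mem_cat P (level l (size w)) (braid_diagram w)) IH.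
split=> [[Pl Pw] [|l1 w1] l2 w2 /= [El Ew]|H]; first by rewrite -El -Ew.
  exact: Pw Ew.
by split=> [|w1 l1 w2 E]; [apply: (H [::])|apply: (H (l :: w1)); rewrite E].
Qed.

Lemma coloring_braid (x : nat -> X) w :
  coloring x (braid_diagram w) <->
  forall w1 w2, w = w1 ++ w2 -> row_of x (size w2) = act w2 (row_of x 0).
Proof.
rewrite /coloring braid_diagram_cases; split=> H.
  move=> w1 w2; elim: w2 w1 => [//|l w2 IH] w1 E.
  by have /coloring_level -> := H _ _ _ E; rewrite (IH (rcons w1 l)) // cat_rcons.
move=> w1 l w2 E; apply/coloring_level.
by rewrite (H w1 (l :: w2)) // (H (rcons w1 l) w2) // cat_rcons.
Qed.

Lemma coloring_closure (x : nat -> X) w :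
  coloring x (braid_closure w) <->
  coloring x (braid_diagram w) /\ row_of x (size w) = row_of x 0.
Proof.
rewrite /coloring forall_mem_cat; split=> -[xw E]; split=> //.
  apply/ffunP => n; rewrite !ffunE; apply: (E (Point ((size w * k + n)%N, val n))).
  by apply: (map_f (fun n => _)); rewrite mem_iota ltn_ord.
move=> _ /mapP[n + ->]; rewrite mem_iota /= add0n => nk.
by have := congr1 (fun f : {ffun 'I_k -> X} => f (Ordinal nk)) E; rewrite !ffunE.
Qed.

Lemma coloring_closure_act (x : nat -> X) w :
  coloring x (braid_closure w) -> act w (row_of x 0) = row_of x 0.
Proof. by case/coloring_closure=> /coloring_braid/(_ [::] w erefl) <- ->. Qed.

Lemma coloring_closure_exists (x0 : X) w (c : colorings X w) :
  exists2 x, coloring x (braid_closure w) & row_of x 0 = sval c.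
Proof.
case: c => c cE /=.
(* Edge [e] lies on string [e %% k] at height [e %/ k], so the suffix of that length has acted below
   it. The default [x0] is reached only for [k = 0]. *)
pose x e := if insub (e %% k)%N is Some i
            then act (drop (size w - e %/ k) w) c i else x0.
have xE j : row_of x j = act (drop (size w - j) w) c.
  apply/ffunP => i; have k0 : (0 < k)%N by apply: leq_ltn_trans (ltn_ord i).
  rewrite ffunE /x modnMDl modn_small // divnMDl // divn_small // addn0.
  by rewrite (valK i).
have xE0 : row_of x 0 = c by rewrite xE subn0 drop_size.
exists x => //; apply/coloring_closure; split; last first.
  by rewrite xE0 xE subnn drop0.
by apply/coloring_braid => w1 w2 E; rewrite xE0 xE E size_cat addnK drop_size_cat.
Qed.

Lemma edges_closure w e : e \in edges (braid_closure w) ->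
  exists w1 w2 (i : 'I_k), w = w1 ++ w2 /\ e = (size w2 * k + i)%N.
Proof.
set P := (P in _ -> P).
have ex w1 w2 (i : 'I_k) : w = w1 ++ w2 -> e = (size w2 * k + i)%N -> P.
  by exists w1, w2, i.
case/mem_outs => p; move: p; apply/forall_mem_cat; split.
  apply/braid_diagram_cases => w1 l w2 E.
  have {}ex j (i : 'I_k) : j \in [:: size w2; (size w2).+1] -> e = (j * k + i)%N -> P.
    rewrite !inE => /orP[]/eqP ->; last exact: (ex w1 (l :: w2)).
    by apply: (ex (rcons w1 l)); rewrite cat_rcons.
  have exl := ex (size w2); have exh := ex (size w2).+1.
  apply/level_cases; split=> [|n _ _].
    by case: l.2; rewrite !inE => /or4P[]/eqP;
      (apply: exl || apply: exh); rewrite !inE eqxx ?orbT.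
  by rewrite !inE => /orP[]/eqP; (apply: exl || apply: exh); rewrite !inE eqxx ?orbT.
move=> _ /mapP[n + ->]; rewrite mem_iota /= add0n => nk.
rewrite !inE => /orP[]/eqP Ee; first exact: (ex [::] w (Ordinal nk)).
by apply: (ex w [::] (Ordinal nk)); rewrite ?cats0.
Qed.

(** * Labelings of a closure as homomorphisms on [G^k] *)

(** This is the identification of [k] homomorphisms from [G] with one homomorphism from [G^k],
    applied to the labels at one height. *)
Definition row_sum (A : zmodType) (phi : nat -> {additive G -> A}) (j : nat)
    (a : {ffun 'I_k -> G}) : A := \sum_(i < k) phi (j * k + i)%N (a i).

Lemma row_sum_is_zmod_morphism (A : zmodType) (phi : nat -> {additive G -> A}) j :
  zmod_morphism (row_sum phi j).
Proof.
move=> a b; rewrite /row_sum -sumrB; apply: eq_bigr => i _.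
by rewrite !ffunE raddfB.
Qed.

HB.instance Definition _ (A : zmodType) (phi : nat -> {additive G -> A}) j :=
  GRing.isZmodMorphism.Build _ _ (row_sum phi j) (row_sum_is_zmod_morphism phi j).

Definition single (i : 'I_k) (g : G) : {ffun 'I_k -> G} :=
  [ffun n => if n == i then g else 0].

Lemma single_is_zmod_morphism i : zmod_morphism (single i).
Proof. by move=> g h; apply/ffunP => n; rewrite !ffunE; case: eqP; rewrite ?subr0. Qed.

HB.instance Definition _ i :=
  GRing.isZmodMorphism.Build _ _ (single i) (single_is_zmod_morphism i).

Lemma row_sum_single (A : zmodType) (phi : nat -> {additive G -> A}) j i g :
  row_sum phi j (single i g) = phi (j * k + i)%N g.
Proof.
rewrite /row_sum (bigD1 i) //= ffunE eqxx big1 ?addr0 // => n /negPf ni.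
by rewrite ffunE ni raddf0.
Qed.

Lemma sum_single (a : {ffun 'I_k -> G}) : a = \sum_i single i (a i).
Proof.
apply/ffunP => n; rewrite sum_ffunE (bigD1 n) //= ffunE eqxx big1 ?addr0 //.
by move=> i /negPf ni; rewrite ffunE eq_sym ni.
Qed.

Lemma eq_on_single (A : zmodType) (f f' : {additive {ffun 'I_k -> G} -> A}) :
  (forall i g, f (single i g) = f' (single i g)) -> f =1 f'.
Proof.
by move=> E a; rewrite [a]sum_single !raddf_sum; apply: eq_bigr => i _.
Qed.

Lemma braid_map_other l x n g : n != lo l.1 -> n != hi l.1 ->
  braid_map m [:: l] x (single n g) = single n g.
Proof.
case: l => i s /= nlo nhi; rewrite eq_sym in nlo; rewrite eq_sym in nhi.
apply/ffunP => n'; rewrite ?ffunE /=.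
case: (eqVneq n' (lo i)) => [->|_].
  case: s; rewrite /= ?ffunE ?(negPf nlo) ?(negPf nhi) //.
  by rewrite (raddf0 (tau _ _ _)) subr0 raddf0.
case: (eqVneq n' (hi i)) => [->|_]; last by rewrite ?ffunE.
by case: s; rewrite /= ?ffunE ?(negPf nlo) (negPf nhi) // /alpha !raddf0 addr0.
Qed.

Lemma braid_map_true_lo i x g :
  braid_map m [:: (i, true)] x (single (lo i) g) =
  single (hi i) (eta m (x (lo i)) (x (hi i)) g).
Proof.
have hl := lo_neq_hi i; have lh := hl; rewrite eq_sym in lh.
apply/ffunP => n; rewrite ?ffunE /=.
case: (eqVneq n (lo i)) => [->|_]; first by rewrite ?ffunE /= ?hl ?lh.
case: (eqVneq n (hi i)) => [_|_]; last by rewrite ?ffunE.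
by rewrite ?ffunE /= /alpha ?eqxx ?lh raddf0 addr0.
Qed.

Lemma braid_map_true_hi i x g :
  braid_map m [:: (i, true)] x (single (hi i) g) =
  single (lo i) g + single (hi i) (tau m (x (lo i)) (x (hi i)) g).
Proof.
have hl := lo_neq_hi i; have lh := hl; rewrite eq_sym in lh.
apply/ffunP => n; rewrite ?ffunE /=.
case: (eqVneq n (lo i)) => [->|_]; first by rewrite ?ffunE /= ?eqxx ?hl ?lh addr0.
case: (eqVneq n (hi i)) => [_|_]; last first.
  by rewrite ?ffunE ?addr0.
by rewrite ?ffunE /= /alpha ?eqxx ?hl raddf0 add0r.
Qed.

Lemma braid_map_false_hi i x g :
  braid_map m [:: (i, false)] x (single (hi i) g) =
  single (lo i) (eta_inv m (x (hi i) |>^-1 x (lo i)) (x (lo i)) g).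
Proof.
have hl := lo_neq_hi i; have lh := hl; rewrite eq_sym in lh.
apply/ffunP => n; rewrite ?ffunE /=.
case: (eqVneq n (lo i)) => [_|_].
  by rewrite ?ffunE /= ?eqxx ?hl ?lh raddf0 subr0.
case: (eqVneq n (hi i)) => [_|_]; first by rewrite ?ffunE ?hl.
by rewrite ?ffunE.
Qed.

Lemma braid_map_false_lo i (x : {ffun 'I_k -> X}) g :
  let z := x (hi i) |>^-1 x (lo i) in
  braid_map m [:: (i, false)] x (single (lo i) g) =
  single (hi i) g - single (lo i) (eta_inv m z (x (lo i)) (tau m z (x (lo i)) g)).
Proof.
have hl := lo_neq_hi i; have lh := hl; rewrite eq_sym in lh.
apply/ffunP => n; rewrite ?ffunE /=.
case: (eqVneq n (lo i)) => [->|_].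
  by rewrite ?ffunE /= ?eqxx ?hl ?lh !sub0r raddfN.
case: (eqVneq n (hi i)) => [_|_].
  by rewrite ?ffunE ?eqxx subr0.
by rewrite ?ffunE ?subr0.
Qed.

(** The crossing rule is the transpose of the generator, so a row is the pullback of the row above
    it; this is checked on vectors with one nonzero entry. For a negative letter the rule must be
    inverted, whence the cancellations of eta. *)
Lemma labeling_level (A : zmodType) (x : nat -> X)
    (phi : nat -> {additive G -> A}) l j :
  coloring x (level l j) ->
  labeling m (with_hom x phi) (level l j) <->
  forall a, row_sum phi j a = row_sum phi j.+1 (braid_map m [:: l] (row_of x j) a).
Proof.
have <- : (forall (i : 'I_k) g, phi (j * k + i)%N g =
      row_sum phi j.+1 (braid_map m [:: l] (row_of x j) (single i g))) <->
    (forall a, row_sum phi j a =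
      row_sum phi j.+1 (braid_map m [:: l] (row_of x j) a)).
  split=> [E a|E i g]; last by rewrite -E row_sum_single.
  by apply: (@eq_on_single A (row_sum phi j)
    (row_sum phi j.+1 \o braid_map m [:: l] (row_of x j))) => i g /=;
    rewrite row_sum_single E.
rewrite /coloring /labeling !level_cases.
case=> xc xp; split=> [[lc lp] n g|E].
  have [->|nlo] := eqVneq n (lo l.1).
    case: l lc xc {xp lp} => i [] /=.
      case=> /= _ _ E _ [_ _].
      by rewrite braid_map_true_lo row_sum_single !ffunE E.
    case=> /= _ _ E E' [xlo /qbarP zE]; rewrite braid_map_false_lo.
    rewrite xlo in E E'.
    rewrite raddfB /= !row_sum_single !ffunE -zE.
    by rewrite E' E eta_invK addrK.
  have [->|nhi] := eqVneq n (hi l.1).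
    case: l lc xc {xp lp nlo} => i [] /=.
      case=> /= _ _ _ E [_ _].
      by rewrite braid_map_true_hi raddfD /= !row_sum_single !ffunE E.
    case=> /= _ _ E _ [xlo /qbarP zE]; rewrite braid_map_false_hi.
    rewrite xlo in E.
    by rewrite !row_sum_single !ffunE -zE E eta_invK.
  rewrite braid_map_other // row_sum_single.
  by have /= [_ ->] := lp n nlo nhi.
split=> [|n nlo nhi]; last first.
  rewrite /= /with_hom (xp n nlo nhi); congr (_, _); apply: additive_ext => g.
  by rewrite E braid_map_other // row_sum_single.
case: l xc E {xp} => i [] /= [E1 E2] E; split=> [||g|g] //=; rewrite ?E1 //.
- by rewrite (E (lo i)) braid_map_true_lo row_sum_single !ffunE.
- by rewrite (E (hi i)) braid_map_true_hi raddfD /= !row_sum_single !ffunE.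
- move/qbarP: E2 => zE; rewrite (E (hi i)) braid_map_false_hi row_sum_single.
  by rewrite !ffunE -zE etaK.
- move/qbarP: E2 => zE; rewrite (E (lo i)) (E (hi i)).
  rewrite braid_map_false_lo braid_map_false_hi raddfB /= !row_sum_single !ffunE -zE.
  by rewrite subrK.
Qed.

Lemma labeling_closure (A : zmodType) (x : nat -> X)
    (phi : nat -> {additive G -> A}) w :
  coloring x (braid_closure w) ->
  labeling m (with_hom x phi) (braid_closure w) <->
  (forall w1 l w2, w = w1 ++ l :: w2 -> forall a, row_sum phi (size w2) a =
     row_sum phi (size w2).+1 (braid_map m [:: l] (row_of x (size w2)) a)) /\
  row_sum phi (size w) =1 row_sum phi 0.
Proof.
move=> xD; have [xw xE] := (coloring_closure x w).1 xD.
have xl := (braid_diagram_cases (piece_coloring x) w).1 xw.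
rewrite /labeling forall_mem_cat braid_diagram_cases; split=> -[H E]; split.
- by move=> w1 l w2 Ew; apply/(labeling_level phi (xl _ _ _ Ew))/(H _ _ _ Ew).
- apply: (@eq_on_single A (row_sum phi (size w)) (row_sum phi 0)) => i g /=.
  rewrite !row_sum_single.
  have : Point ((size w * k + i)%N, val i) \in
      [seq Point (size w * k + n, n)%N | n <- iota 0 k].
    by apply: (map_f (fun n => _)); rewrite mem_iota ltn_ord.
  by move/E => /= [_ ->].
- by move=> w1 l w2 Ew; apply/(labeling_level phi (xl _ _ _ Ew))/(H _ _ _ Ew).
- move=> _ /mapP[n + ->]; rewrite mem_iota /= add0n => nk.
  have := congr1 (fun f : {ffun 'I_k -> X} => f (Ordinal nk)) xE.
  rewrite !ffunE /with_hom /= => ->; congr (_, _); apply: additive_ext => g.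
  by have := E (single (Ordinal nk) g); rewrite !row_sum_single.
Qed.

(** This is the universal property of the cokernel of [M - I]. The induced map evaluates [f] on
    chosen representatives; it is additive because [f] kills every [M d - d]. *)
Lemma braid_quotient_pi w (c : {ffun 'I_k -> X}) :
  exists p : {additive {ffun 'I_k -> G} -> braid_quotient m w c},
  [/\ forall q, exists a, p a = q,
      forall a, p (braid_map m w c a) = p a &
      forall (A : zmodType) (f : {additive {ffun 'I_k -> G} -> A}),
        (forall a, f (braid_map m w c a) = f a) ->
        exists h : {additive braid_quotient m w c -> A}, forall a, h (p a) = f a].
Proof.
pose p : {additive {ffun 'I_k -> G} -> braid_quotient m w c} :=
  \pi_(Quotient.quot (im_map_sub m w c))%qT.
have pE a b : p a = p b <-> exists d, a - b = braid_map m w c d - d.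
  have := Quotient.idealrBE (im_map_sub m w c) a b.
  move=> E; split=> [/eqP|[d ab]].
    by rewrite -E => /asboolP.
  by apply/eqP; rewrite -E; apply/asboolP; exists d.
exists p; split=> [q|a|A f fM].
- by exists (repr q); rewrite /p /= reprK.
- by apply/pE; exists a.
have fp a b : p a = p b -> f a = f b.
  by case/pE=> d ab; apply/eqP; rewrite -subr_eq0 -raddfB ab raddfB fM subrr.
have pK q : p (repr q) = q by rewrite /p /= reprK.
have hB : zmod_morphism (fun q : braid_quotient m w c => f (repr q)).
  by move=> q q'; rewrite -raddfB; apply: fp; rewrite raddfB !pK.
pose H := GRing.isZmodMorphism.Build _ _ _ hB.
pose h : {additive braid_quotient m w c -> A} :=
  HB.pack (fun q : braid_quotient m w c => f (repr q)) H.
by exists h => a; apply: fp; rewrite pK.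
Qed.

Lemma bottom_edge w (i : 'I_k) : val i \in edges (braid_closure w).
Proof.
rewrite /edges outs_cat mem_cat; apply/orP; right.
rewrite /outs -map_comp flatten_map1 -map_comp.
by apply/mapP; exists (val i); rewrite ?mem_iota ?ltn_ord.
Qed.

Lemma eq_coloring_closure (x y : nat -> X) w :
  coloring x (braid_closure w) -> coloring y (braid_closure w) ->
  {in edges (braid_closure w), x =1 y} <-> row_of x 0 = row_of y 0.
Proof.
move=> /coloring_closure[/coloring_braid xw _] /coloring_closure[/coloring_braid yw _].
split=> [E|E e /edges_closure[w1 [w2 [i [Ew ->]]]]].
  by apply/ffunP => i; rewrite !ffunE; apply/E/bottom_edge.
have := congr1 (fun f : {ffun 'I_k -> X} => f i) (xw _ _ Ew).
by rewrite E -(yw _ _ Ew) !ffunE.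
Qed.

Lemma universal_closure (x : nat -> X) w : coloring x (braid_closure w) ->
  universal m (braid_closure w) x (braid_quotient m w (row_of x 0)).
Proof.
move=> xD; have [/coloring_braid xw xE] := (coloring_closure x w).1 xD.
have [p [psurj pM pU]] := braid_quotient_pi w (row_of x 0).
(* The label of an edge is the class of the vector obtained by pushing that
   coordinate up to the top of the braid. *)
pose u e : {additive G -> braid_quotient m w (row_of x 0)} :=
  if insub (e %% k)%N is Some i
  then p \o (braid_map m (take (size w - e %/ k) w) (row_of x (e %/ k)) \o single i)
  else \0.
have u_row w1 w2 : w = w1 ++ w2 -> forall a,
    row_sum u (size w2) a = p (braid_map m w1 (row_of x (size w2)) a).
  move=> Ew; apply: (@eq_on_single _ (row_sum u (size w2))
    (p \o braid_map m w1 (row_of x (size w2)))) => i g /=.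
  have k0 : (0 < k)%N by apply: leq_ltn_trans (ltn_ord i).
  rewrite row_sum_single /u modnMDl modn_small // divnMDl // divn_small // addn0.
  have -> : take (size w - size w2) w = w1 by rewrite Ew size_cat addnK take_size_cat.
  by rewrite (valK i).
have braid_map_nil y a : braid_map m [::] y a = a by apply/ffunP => i; rewrite !ffunE.
have xl w1 l w2 : w = w1 ++ l :: w2 ->
    act [:: l] (row_of x (size w2)) = row_of x (size w2).+1.
  move=> Ew; rewrite (xw w1 (l :: w2) Ew).
  by rewrite (xw (rcons w1 l) w2) // cat_rcons.
exists u; split.
- apply/labeling_closure => //; split=> [w1 l w2 Ew a|a].
    have Ew' : w = (w1 ++ [:: l]) ++ w2 by rewrite -catA.
    by rewrite (u_row _ _ Ew') (u_row _ (l :: w2) Ew) braid_map_cat (xl _ _ _ Ew).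
  rewrite (u_row [::] w) // braid_map_nil (u_row w [::]) ?cats0 //.
- move=> A phi /labeling_closure-/(_ xD)[H E].
  (* Each row is the pullback of the top row along the part [w1] of the braid above it, and closing
     up identifies the top row with the bottom one. For empty [w2] this says that the bottom row is
     invariant under [M]. *)
  have Hr w1 w2 : w = w1 ++ w2 -> forall a, row_sum phi (size w2) a =
      row_sum phi 0 (braid_map m w1 (row_of x (size w2)) a).
    elim/last_ind: w1 w2 => [|w1 l IH] w2 Ew a.
      by rewrite braid_map_nil -E Ew.
    rewrite cat_rcons in Ew.
    by rewrite (H _ _ _ Ew) (IH _ Ew) -cats1 braid_map_cat (xl _ _ _ Ew).
  have [a|h hE] := pU _ (row_sum phi 0).
    by have /= <- := Hr w [::] (esym (cats0 w)) a.
  exists h => e /edges_closure[w1 [w2 [i [Ew ->]]]] g /=.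
  by rewrite -!row_sum_single (u_row _ _ Ew) hE (Hr _ _ Ew).
- move=> A h h' E q; have [a <-] := psurj q.
  apply: (@eq_on_single _ (h \o p) (h' \o p)) => i g /=.
  have iE := bottom_edge w i.
  have uE : u i g = p (single i g).
    by rewrite -[i : nat]/(0 * k + i)%N -row_sum_single (u_row w [::]) ?cats0.
  by have /= := E _ iE g; rewrite uE.
Qed.

End Closure.

Lemma braid_closure_nil k (w : braid_word k) :
  (braid_closure w == [::]) = (k == 0%N).
Proof.
case: k w => [[|[[]]]|k w] //.
by rewrite /braid_closure; case: (braid_diagram w).
Qed.

Theorem theorem4p2 (X : quandle) (G : zmodType) (m : quandle_module X G)
    (k k' : nat) (w : braid_word k) (w' : braid_word k') :
  same_link (braid_closure w) (braid_closure w') ->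
  exists f : colorings X w -> colorings X w',
    bijective f /\
    forall c : colorings X w,
      zmod_isomorphic (braid_quotient m w (sval c))
                      (braid_quotient m w' (sval (f c))).
Proof.
move=> ww'.
(* Extending a color vector to all natural numbers needs a default color. If [X] is empty, either
   both braids have no strings, so both words are empty, or neither has a coloring. *)
have [[x0 _]|noX] := pselect (exists x0 : X, True); last first.
  have kk' := same_link_nil ww'; rewrite !braid_closure_nil in kk'.
  have empty n (v : braid_word n.+1) : colorings X v -> False.
    by case=> c _; apply: noX; exists (c ord0).
  case: k k' w w' kk' {ww'} => [|k] [|k'] w w' // _.
    have -> : w = [::] by case: w => // -[[]].
    have -> : w' = [::] by case: w' => // -[[]].
    exists id; split; first by exists id.
    by move=> c; exists idfun; exists id.
  exists (fun c => False_rect _ (empty _ _ c)); split=> [|c];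
    last by case: (empty _ _ c).
  by exists (fun c => False_rect _ (empty _ _ c)) => c; case: (empty _ _ c).
have [R [R1 R2 R3 R4 R5]] := same_link_equivalent m ww'.
(* [F] is [R] read on bottom rows; as a coloring of a closure is determined by its bottom row, [F]
   is the graph of a bijection. *)
pose F (c : colorings X w) (c' : colorings X w') := exists x x',
  [/\ row_of k x 0 = sval c, R x x' & row_of k' x' 0 = sval c'].
have F_total c : exists c', F c c'.
  have [x xD xc] := coloring_closure_exists x0 c.
  have [x' r] := R2 _ xD; have [_ xD'] := R1 _ _ r.
  by exists (exist (fun c => act w' c = c) _ (coloring_closure_act xD')), x, x'.
have F_surj c' : exists c, F c c'.
  have [x' xD' xc'] := coloring_closure_exists x0 c'.
  have [x r] := R3 _ xD'; have [xD _] := R1 _ _ r.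
  by exists (exist (fun c => act w c = c) _ (coloring_closure_act xD)), x, x'.
have F_bij c1 c2 c1' c2' : F c1 c1' -> F c2 c2' -> c1 = c2 <-> c1' = c2'.
  move=> [x1 [x1' [E1 r1 E1']]] [x2 [x2' [E2 r2 E2']]].
  have [xD1 xD1'] := R1 _ _ r1; have [xD2 xD2'] := R1 _ _ r2.
  have := R4 _ _ _ _ r1 r2; rewrite !eq_coloring_closure // E1 E2 E1' E2'.
  case: c1 c2 c1' c2' {E1 E2 E1' E2'} => [c1 ?] [c2 ?] [c1' ?] [c2' ?] /= H.
  by split=> -[E]; apply: eq_exist; apply/H.
have [f fF] := choice F_total; have [g gF] := choice F_surj.
exists f; split.
  exists g => c.
    by apply/(F_bij _ _ _ _ (gF _) (fF c)).
  by apply/(F_bij _ _ _ _ (fF _) (gF c)).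
move=> c; have [x [x' [<- r <-]]] := fF c.
have [xD xD'] := R1 _ _ r.
apply: (universal_iso _ (universal_closure m xD')).
by apply/(R5 _ _ _ r); apply: universal_closure.
Qed.
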